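(* Let $J$ be a general abelian surface and let $Z\subset\mathbf{P}B^2$ be the Zariski closure of $\bigcup_K\mathbf{P}B^2_K$, the union being over all Cartan subalgebras $K\subset M_2(\mathbf{C})$. (i) A Hodge class in $Z-\operatorname{Sing}(Z)$ (that is, a nonzero $c\in B^2(J^2)$ whose point in $\mathbf{P}B^2$ lies in $Z-\operatorname{Sing}(Z)$) deforms in at most one four-dimensional family of abelian fourfolds of Weil type: there is at most one imaginary quadratic subfield $K\subset M_2(\mathbf{Q})$ such that $c$ deforms in the family determined by $K$. (ii) A Hodge class in $\operatorname{Sing}(Z)$ may deform in infinitely many four-dimensional families of Weil type with distinct imaginary quadratic fields: there exist nonzero classes $c\in B^2(J^2)$ whose point in $\mathbf{P}B^2$ lies in $\operatorname{Sing}(Z)$ and which deform in the families determined by infinitely many pairwise non-isomorphic imaginary quadratic subfields $K\subset M_2(\mathbf{Q})$.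
   Context: ''General'' means that the Hodge group of $H^1(J,\mathbf{Q})$ is the full symplectic group $\mathrm{Sp}_4$ of a polarization $\omega_J$; in particular $\operatorname{End}_{\mathbf{Q}}(J)=\mathbf{Q}$ and $\operatorname{End}_{\mathbf{Q}}(J^2)=M_2(\mathbf{Q})$. Choose a basis $dt_1,\dots,dt_4$ of $H^1(J,\mathbf{Q})$ with $\omega_J=dt_1\wedge dt_2+dt_3\wedge dt_4$ ($\omega_J$ the class of an ample divisor), put $dx_j=\pi_1^*dt_j$, $dy_j=\pi_2^*dt_j$ with $\pi_i:J^2\to J$ the projections, and $$\omega_1=dx_1\wedge dx_2+dx_3\wedge dx_4,\quad \omega_2=dy_1\wedge dy_2+dy_3\wedge dy_4,\quad \omega_\sigma=dx_1\wedge dy_2-dx_2\wedge dy_1+dx_3\wedge dy_4-dx_4\wedge dy_3 .$$ Let $B^p(J^2)=H^{2p}(J^2,\mathbf{Q})\cap H^{p,p}(J^2)$ and $B^p:=B^p(J^2)\otimes_{\mathbf{Q}}\mathbf{C}$. Then $\omega_1,\omega_\sigma,\omega_2$ is a basis of $B^1(J^2)$ and the six products $\omega_1^2,\omega_1\omega_2,\omega_2^2,\omega_1\omega_\sigma,\omega_2\omega_\sigma,\omega_\sigma^2$ form a basis of $B^2(J^2)$. $\mathbf{P}V$ denotes the projective space of lines in $V$. A Cartan subalgebra of $M_2(\mathbf{C})$ is a diagonalizable two-dimensional subalgebra $K$; it is determined by a basis of common eigenvectors $v_\pm=(\alpha_\pm,\beta_\pm)\in\mathbf{C}^2$. Put $$\omega_\pm:=\alpha_\pm^2\omega_1+\alpha_\pm\beta_\pm\omega_\sigma+\beta_\pm^2\omega_2,\qquad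 \omega_K:=2\alpha_+\alpha_-\omega_1+(\alpha_+\beta_-+\alpha_-\beta_+)\omega_\sigma+2\beta_+\beta_-\omega_2 ,$$ and $B^2_K:=\mathbf{C}\omega_K^2\oplus\mathbf{C}\omega_+^2\oplus\mathbf{C}\omega_-^2\subset B^2$. An imaginary quadratic subfield $K\subset M_2(\mathbf{Q})$ gives the Cartan subalgebra $K\otimes_{\mathbf{Q}}\mathbf{C}$, whose eigenvectors can be taken to be $v_\pm=(\alpha_\pm,1)$ with $\alpha_\pm\in K$ conjugate. The field $K$ acts on $J^2$ so that $k^*$ on cohomology is $k\cdot\omega=({}^tk)^*\omega$; then $\omega_K\in B^1(J^2)$ is, up to scalar, the unique polarization with $k^*\omega_K=k\bar k\,\omega_K$ for all $k\in K$, and $(J^2,K,\omega_K)$ is a polarized abelian fourfold of Weil type, i.e. the eigenvalues $k,\bar k$ on $H^{1,0}$ have equal multiplicity for all $k\in K$. Varying the complex structure on $H_1(J^2,\mathbf{R})$, keeping the $K$-action complex linear and of Weil type and keeping $\omega_K$ a polarization, gives the four-dimensional family of abelian fourfolds of Weil type determined by $K$. For each member $A$, $H^4(A,\mathbf{Q})=H^4(J^2,\mathbf{Q})$, and the three-dimensional space of Hodge classes $B^2_{K,A}=\mathbf{Q}\omega_K^2\oplus W_{K,A}$ of $(A,K,\omega_K)$ is the same subspace for all members $A$, equal to $B^2_{K,J^2}:=\mathbf{Q}\omega_K^2\oplus W_K$, where $W_K\subset B^2(J^2)$ is the $\mathbf{Q}$-subspace with $W_K\otimes_{\mathbf{Q}}K=K\omega_+^2\oplus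 K\omega_-^2$; its complexification is $B^2_K$. For a general member $A$ of the family, $B^2(A)=B^2_{K,A}$. A class $c\in B^2(J^2)$ deforms in the family determined by $K$ if $c\in B^2_{K,J^2}$ (so that $c$ remains a Hodge class on all members of the family). *)

(* Defs.v *)
From HB Require Import structures.
From mathcomp Require Import all_boot all_order all_algebra.
From mathcomp Require Import boolp classical_sets reals complex mpoly.

Set Implicit Arguments.
Unset Strict Implicit.
Unset Printing Implicit Defensive.

Import Order.TTheory GRing.Theory Num.Theory.
Local Open Scope classical_set_scope.
Local Open Scope ring_scope.

Section Span.
Variables (F : fieldType) (V : vectType F).

Definition is_vspan (P : set V) (U : {vspace V}) : Prop :=
  (forall x, P x -> x \in U) /\
  (forall U' : {vspace V}, (forall x, P x -> x \in U') -> (U <= U')%VS).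

Definition vspan (P : set V) : {vspace V} := xget 0%VS (is_vspan P).

Lemma vspanP (P : set V) : is_vspan P (vspan P).
Proof.
suff [U hU] : exists U, is_vspan P U by rewrite /vspan; apply: xgetPex; exists U.
pose good k := `[< exists2 s : seq V, (forall x, x \in s -> P x) &
  \dim <<s>>%VS = k >].
have ex_good : exists k, good k.
  by exists (\dim <<([::] : seq V)>>%VS); apply/asboolP; exists [::].
have ub k : good k -> (k <= \dim {:V})%N.
  by move=> /asboolP[s _ <-]; apply/dimvS/subvf.
case: (ex_maxnP ex_good ub) => k /asboolP[s sP ks] kmax.
exists <<s>>%VS; split=> [x Px|U' PU']; last first.
  by apply/span_subvP => x /sP; apply: PU'.
have lek : (\dim <<x :: s>> <= \dim <<s>>)%N.
  rewrite ks; apply: kmax; apply/asboolP; exists (x :: s) => // y.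
  by rewrite inE => /orP[/eqP->//|/sP].
have sub : (<<s>> <= <<x :: s>>)%VS by rewrite span_cons addvSr.
have /eqP-> : (<<s>> == <<x :: s>>)%VS by rewrite eqEdim sub.
by rewrite memv_span // inE eqxx.
Qed.

End Span.

Section Projective.
Variables (F : fieldType) (V : vectType F) (U : {vspace V}).

Definition proj := {L : {vspace V} | (L <= U)%VS && (\dim L == 1%N)}.

(* Value at x in U of a polynomial in the coordinates with respect to a basis
   of U; all the notions below are independent of this basis. *)
Definition peval (f : {mpoly F[\dim U]}) (x : V) : F :=
  f.@[fun i => coord (vbasis U) i x].

Definition homogeneous (f : {mpoly F[\dim U]}) : Prop :=
  exists d : nat, f \is d.-homog.

Definition vanishes_at (f : {mpoly F[\dim U]}) (L : proj) : Prop :=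
  forall x, x \in \val L -> peval f x = 0.

Definition zclosed (X : set proj) : Prop :=
  exists2 S : set {mpoly F[\dim U]}, (forall f, S f -> homogeneous f) &
    forall L, X L <-> (forall f, S f -> vanishes_at f L).

Definition zclosure (X : set proj) : set proj :=
  [set L | forall Y : set proj, zclosed Y -> X `<=` Y -> Y L].

Definition zirreducible (X : set proj) : Prop :=
  X !=set0 /\ forall A B : set proj, zclosed A -> zclosed B ->
    X `<=` A `|` B -> X `<=` A \/ X `<=` B.

(* A chain X 0 < ... < X d of irreducible closed subsets of Z through L, that
   is, a chain of d + 1 prime ideals in the local ring of Z at L. *)
Definition irr_chain (Z : set proj) (L : proj) (d : nat)
    (X : nat -> set proj) : Prop :=
  [/\ X 0%N L, X d `<=` Z,
      forall i, (i <= d)%N -> zclosed (X i) /\ zirreducible (X i) &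
      forall i, (i < d)%N -> X i `<=` X i.+1 /\ X i <> X i.+1].

(* The local dimension of Z at L: the Krull dimension of the local ring. *)
Definition local_dim (Z : set proj) (L : proj) (d : nat) : Prop :=
  (exists X, irr_chain Z L d X) /\ ~ (exists X, irr_chain Z L d.+1 X).

(* T is the tangent space at the points of L of the affine cone over Z; the
   projective tangent space of Z at L is P(T), of dimension \dim T - 1. *)
Definition is_tangent_cone_space (Z : set proj) (L : proj) (T : {vspace V}) :
    Prop :=
  forall v, v \in T <->
    v \in U /\
    forall f : {mpoly F[\dim U]}, homogeneous f ->
      (forall L', Z L' -> vanishes_at f L') ->
      forall x, x \in \val L ->
        \sum_(i < \dim U) peval f^`M(i) x * coord (vbasis U) i v = 0.

Definition nonsingular_at (Z : set proj) (L : proj) : Prop :=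
  exists (d : nat) (T : {vspace V}),
    [/\ local_dim Z L d, is_tangent_cone_space Z L T & \dim T = d.+1].

Definition Sing (Z : set proj) : set proj :=
  [set L | Z L /\ ~ nonsingular_at Z L].

End Projective.

Section Exterior.
Variables (F : fieldType) (n : nat).

(* The coefficient at S = {s_1 < ... < s_k} is that of the basis element
   e_(s_1) /\ ... /\ e_(s_k). *)
Definition ext := {ffun {set 'I_n} -> F^o}.

(* e_S /\ e_T = (-1)^(inversions S T) e_(S :|: T) for disjoint S and T. *)
Definition inversions (S T : {set 'I_n}) : nat :=
  \sum_(i in S) \sum_(j in T) (j < i)%N.

Definition wedge (a b : ext) : ext :=
  [ffun W : {set 'I_n} => \sum_(S : {set 'I_n} | S \subset W)
     (-1) ^+ inversions S (W :\: S)%SET * (a S * b (W :\: S)%SET)].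

Definition ext_one : ext := [ffun S : {set 'I_n} => (#|S| == 0%N)%:R].

Definition wedges (s : seq ext) : ext := foldr wedge ext_one s.

Definition gen (j : 'I_n) : ext := [ffun S : {set 'I_n} => (S == [set j]%SET)%:R].

Definition ext_of_row (phi : 'rV[F]_n) : ext := \sum_(j < n) phi 0 j *: gen j.

End Exterior.

(* A torus A = H_1(A,R) / H_1(A,Z) with a chosen basis of H_1(A,Q) has
   H^*(A,Q) = ext rat n; its complex structure is a matrix I, acting on the
   column vectors of H_1(A,R), with I^2 = -1. *)

Section Hodge.
Variables (R : realType) (n : nat) (I : 'M[R]_n).
Local Notation C := R[i].

Definition complexify (c : ext rat n) : ext C n := [ffun S => ratr (c S)].

Definition I_C : 'M[C]_n := map_mx (real_complex R) I.

Definition H10 : set (ext C n) :=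
  [set a | exists2 phi : 'rV[C]_n, phi *m I_C = 'i *: phi & a = ext_of_row phi].

Definition H01 : set (ext C n) :=
  [set a | exists2 phi : 'rV[C]_n,
     phi *m I_C = (- 'i) *: phi & a = ext_of_row phi].

Definition Hpq (p q : nat) : {vspace ext C n} :=
  vspan [set a | exists s t : seq (ext C n),
    [/\ size s = p, size t = q,
        forall x, x \in s -> H10 x, forall x, x \in t -> H01 x &
        a = wedges (s ++ t)]].

(* The elements of B^p = H^(2p)(A,Q) /\ H^(p,p)(A). *)
Definition hodge_class (p : nat) (c : ext rat n) : Prop :=
  complexify c \in Hpq p p.

Definition hodge_space (p : nat) : {vspace ext C n} :=
  vspan [set x | exists2 c, hodge_class p c & x = complexify c].

End Hodge.

(* The matrix of dt_1 /\ dt_2 + dt_3 /\ dt_4 as an alternating form on H_1. *)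
Definition Omega (F : nzRingType) : 'M[F]_4 :=
  delta_mx 0 1 - delta_mx 1 0 + delta_mx 2 3 - delta_mx 3 2.

(* An abelian surface J together with a basis dt_1, ..., dt_4 of H^1(J,Q) in
   which the class of some ample divisor is dt_1 /\ dt_2 + dt_3 /\ dt_4. The
   space H_1(J,Q) is identified with Q^4 by the dual basis. *)
Record abelian_surface (R : realType) := AbelianSurface {
  (* its columns are a basis of the lattice H_1(J,Z) *)
  lattice : 'M[rat]_4;
  cplx : 'M[R]_4;
  lattice_unit : lattice \in unitmx;
  cplx_sqr : cplx *m cplx = (-1)%:M;
  ample_integral :
    forall i j, (lattice^T *m Omega rat *m lattice) i j \is a Num.int;
  ample_compatible : cplx^T *m Omega R *m cplx = Omega R;
  ample_positive : forall x : 'cV[R]_4, x != 0 ->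
    0 < (x^T *m Omega R *m (cplx *m x)) 0 0
}.

Section HodgeGroup.
Variables (R : realType) (J : abelian_surface R).
Local Notation C := R[i].

(* The complex points of the closed subset of GL_4 defined by a set of
   polynomials with rational coefficients in the 16 matrix entries. *)
Definition Qclosed_points (S : set {mpoly rat[4 * 4]}) : set 'M[C]_4 :=
  [set g | g \in unitmx /\
    forall f, S f -> (map_mpoly ratr f).@[fun k => mxvec g 0 k] = 0].

Definition is_subgroup (G : set 'M[C]_4) : Prop :=
  [/\ G 1%:M, forall g h, G g -> G h -> G (g *m h) &
      forall g, G g -> G (invmx g)].

(* The action of a + b 'i in U(1) on H^1(J,R), on column vectors of
   coordinates in the basis dt_1, ..., dt_4. *)
Definition circle_action (a b : R) : 'M[C]_4 :=
  map_mx (real_complex R) (a%:M + b *: (cplx J)^T).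

(* The complex points of the smallest algebraic subgroup over Q of GL(H^1(J,Q))
   that contains the image of U(1). *)
Definition hodge_group : set 'M[C]_4 :=
  [set g | forall S, is_subgroup (Qclosed_points S) ->
    (forall a b : R, a ^+ 2 + b ^+ 2 = 1 ->
       Qclosed_points S (circle_action a b)) ->
    Qclosed_points S g].

Definition Sp4 : set 'M[C]_4 := [set g | g *m Omega C *m g^T = Omega C].

Definition general : Prop := hodge_group = Sp4.

End HodgeGroup.

Section Square.
Variables (R : realType) (J : abelian_surface R).

Definition cplx2 : 'M[R]_(4 + 4) := block_mx (cplx J) 0 0 (cplx J).

Definition hodge_class_JJ (p : nat) (c : ext rat (4 + 4)) : Prop :=
  hodge_class cplx2 p c.

(* B^2 = B^2(J^2) (x) C *)
Definition B2 : {vspace ext R[i] (4 + 4)} := hodge_space cplx2 2.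

End Square.

Section Classes.
Variable F : fieldType.
Local Notation extF := (ext F (4 + 4)).

Definition dx (j : 'I_4) : extF := gen F (lshift 4 j).
Definition dy (j : 'I_4) : extF := gen F (rshift 4 j).

Definition omega1 : extF := wedge (dx 0) (dx 1) + wedge (dx 2) (dx 3).
Definition omega2 : extF := wedge (dy 0) (dy 1) + wedge (dy 2) (dy 3).
Definition omega_sigma : extF :=
  wedge (dx 0) (dy 1) - wedge (dx 1) (dy 0)
  + wedge (dx 2) (dy 3) - wedge (dx 3) (dy 2).

Definition omega_vec (v : 'cV[F]_2) : extF :=
  v 0 0 ^+ 2 *: omega1 + (v 0 0 * v 1 0) *: omega_sigma
  + v 1 0 ^+ 2 *: omega2.

Definition omega_pair (v w : 'cV[F]_2) : extF :=
  (2 * v 0 0 * w 0 0) *: omega1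
  + (v 0 0 * w 1 0 + w 0 0 * v 1 0) *: omega_sigma
  + (2 * v 1 0 * w 1 0) *: omega2.

Definition sq (a : extF) : extF := wedge a a.

(* B^2_K for the Cartan subalgebra K with eigenvectors v_+ = v and v_- = w *)
Definition B2K (v w : 'cV[F]_2) : {vspace extF} :=
  <<[:: sq (omega_pair v w); sq (omega_vec v); sq (omega_vec w)]>>%VS.

Definition cartan (K : {vspace 'M[F]_2}) : Prop :=
  [/\ 1%:M \in K, {in K &, forall k l, k *m l \in K}, \dim K = 2%N &
      exists2 P : 'M[F]_2, P \in unitmx &
        {in K, forall k, is_diag_mx (P *m k *m invmx P)}].

Definition common_eigenbasis (K : {vspace 'M[F]_2}) (v w : 'cV[F]_2) : Prop :=
  row_mx v w \in unitmx /\
  {in K, forall k, (exists a, k *m v = a *: v) /\ (exists b, k *m w = b *: w)}.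

End Classes.

Section Locus.
Variables (R : realType) (J : abelian_surface R).
Local Notation C := R[i].

Definition cartan_union : set (proj (B2 J)) :=
  [set L | exists (K : {vspace 'M[C]_2}) (v w : 'cV[C]_2),
    [/\ cartan K, common_eigenbasis K v w & (\val L <= B2K v w)%VS]].

Definition Z : set (proj (B2 J)) := zclosure cartan_union.

End Locus.

Arguments cartan_union {R} J _.
Arguments Z {R} J _.

Definition imaginary_quadratic (K : {vspace 'M[rat]_2}) : Prop :=
  [/\ 1%:M \in K,
      {in K &, forall k l, k *m l \in K /\ k *m l = l *m k},
      {in K, forall k, k != 0 -> k \in unitmx /\ invmx k \in K},
      \dim K = 2%N &
      exists k d, [/\ k \in K, 0 < d & k *m k = (- d)%:M]].

Definition field_isomorphic (K L : {vspace 'M[rat]_2}) : Prop :=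
  exists f : 'M[rat]_2 -> 'M[rat]_2,
    [/\ {in K &, injective f}, forall y, y \in L <-> exists2 x, x \in K & f x = y,
        f 1%:M = 1%:M, {in K &, {morph f : x y / x + y}} &
        {in K &, {morph f : x y / x *m y}}].

Section Deformation.
Variables (R : realType) (J : abelian_surface R) (K : {vspace 'M[rat]_2}).
Local Notation C := R[i].

Definition tensorC : {vspace 'M[C]_2} :=
  <<[seq map_mx ratr k | k : 'M[rat]_2 <- vbasis K]>>%VS.

(* The image of K in C under the character by which it acts on v. *)
Definition K_in_C (v : 'cV[C]_2) : set C :=
  [set a | exists2 k, k \in K & map_mx ratr k *m v = a *: v].

Definition vec1 (a : C) : 'cV[C]_2 := \col_i (if i == 0 then a else 1).

(* W is the Q-subspace W_K of B^2(J^2) with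
   W_K (x)_Q K = K omega_+^2 (+) K omega_-^2, for v_+ = v and v_- = w. *)
Definition is_WK (v w : 'cV[C]_2) (W : {vspace ext rat (4 + 4)}) : Prop :=
  {in W, forall c, hodge_class_JJ J 2 c} /\
  forall x : ext C (4 + 4),
    (exists2 a : 'I_(\dim W) -> C, forall i, K_in_C v (a i) &
       x = \sum_i a i *: complexify R (vbasis W)`_i) <->
    (exists a b : C, [/\ K_in_C v a, K_in_C v b &
       x = a *: sq (omega_vec v) + b *: sq (omega_vec w)]).

(* c lies in B^2_(K,J^2) = Q omega_K^2 (+) W_K *)
Definition deforms (c : ext rat (4 + 4)) : Prop :=
  exists (a : C) (W : {vspace ext rat (4 + 4)}) (q : rat) (w : ext rat (4 + 4)),
    let v_plus := vec1 a in
    let v_minus := vec1 (a^*) in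
    [/\ K_in_C v_plus a, common_eigenbasis tensorC v_plus v_minus,
        is_WK v_plus v_minus W, w \in W &
        complexify R c =
          ratr q *: sq (omega_pair v_plus v_minus) + complexify R w].

End Deformation.

(* Main.v *)
Require Import Defs.
From mathcomp Require Import all_boot all_order all_algebra.
From mathcomp Require Import boolp classical_sets reals complex mpoly ring zify.
(* After the classical sets, so that the lemma names shared by both theories are
   those of finite sets. *)
From mathcomp Require Import fintype finset.

Set Implicit Arguments.
Unset Strict Implicit.
Unset Printing Implicit Defensive.

Import Order.TTheory GRing.Theory Num.Theory.
Local Open Scope ring_scope.

(** Why the theorem holds.  Identify B^1 (x) C with Sym^2 C^2 by e_1^2 =
    omega_1, 2 e_1 e_2 = omega_sigma, e_2^2 = omega_2, so that omega_vec v is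
    v^2 and omega_pair v w is 2 v w.  The six products of omega_1, omega_sigma,
    omega_2 are linearly independent ([sixprod_free]), hence their span, the
    image of [Psi], is Sym^2 (Sym^2 C^2), and a point of B^2_K is
    Q = a (v^2)^2 + b (w^2)^2 + 4 q (vw)^2.  With delta = omega_sigma^2 -
    4 omega_1 omega_2 = 4 ((e_1 e_2)^2 - e_1^2 e_2^2), the invariant of
    Sym^2 (Sym^2), one has
    4 (vw)^2 = 4 v^2 w^2 + det(v,w)^2 delta, and an equivariant linear form T
    recovers the multiple q det(v,w)^2 of delta from Q.  The linear automorphism
    Q |-> Q' = Q - T(Q) delta therefore turns B^2_K into Sym^2 <v^2, w^2>, and
    turns Z into the set of quadratic tensors Q' of rank at most 2, a cubic
    hypersurface in the P^5 of that span, which is singular along the tensors of rank 1.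

    Part (i).  If Q' lies in Sym^2 <v^2, w^2> and in Sym^2 <v'^2, w'^2> for two
    disjoint pairs of points, contracting Q' with the linear form on Sym^2 that
    kills v^2 and w^2 shows that Q' is the square of one element of Sym^2
    ([pencil_eqs]); so the point is singular on Z ([singular_point]).  Two
    imaginary quadratic fields that share an eigenline coincide
    ([quadratic_field_eq]).

    Part (ii).  The class omega_sigma^2 + 4 omega_1 omega_2 corresponds to a
    multiple of the square of e_1 e_2, which lies in <v^2, w^2> for
    v, w = (+- sqrt(-d), 1), whatever d > 0; distinct primes d give
    non-isomorphic fields.

    Singularity at a point x of rank 1 ([rank_one_singular]).  Writing
    x' = (v^2 + w^2)^2, the form v^2 + w^2 is also a multiple of v_t^2 + w_t^2
    for v_t = v + t w, w_t = w - t v, so the ideal of Z vanishes on a family of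
    linear spaces through x which together span the six products: the tangent
    space at x of the cone over Z has dimension at least 6.  On the other hand
    a chain of irreducible closed subsets of Z has at most 5 members
    ([local_dim_Z]), since Z is the closure of the image of a polynomial map
    from the affine space of dimension 5 ([pencil_chart]).  The bound
    ([chain_length]) is a count of monomials: a chain X_0 < ... < X_d gives, for
    every M, a family of M^(d+1) polynomials of degree O(M) that is free modulo
    the ideal of X_d, whereas k variables leave room for only O(M^k).

    The six products lie in B^2, because the complex structure preserves the
    polarization ([sixprod_Hpq]). *)

(** * The exterior algebra *)

Section WedgeAlgebra.
Variables (F : fieldType) (n : nat).
Local Notation E := (ext F n).
Implicit Types (a b c : E) (S T U W : {set 'I_n}).

Lemma wedgeDl a b c : wedge (a + b) c = wedge a c + wedge b c.
Proof.
apply/ffunP => W; rewrite !ffunE -big_split /=; apply: eq_bigr => S _.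
by rewrite !ffunE mulrDl mulrDr.
Qed.

Lemma wedgeDr a b c : wedge a (b + c) = wedge a b + wedge a c.
Proof.
apply/ffunP => W; rewrite !ffunE -big_split /=; apply: eq_bigr => S _.
by rewrite !ffunE !mulrDr.
Qed.

Lemma wedgeZl (k : F) a b : wedge (k *: a) b = k *: wedge a b.
Proof.
apply/ffunP => W; rewrite !ffunE /GRing.scale /= mulr_sumr.
by apply: eq_bigr => S _; rewrite !ffunE /GRing.scale /= -mulrA mulrCA.
Qed.

Lemma wedgeZr (k : F) a b : wedge a (k *: b) = k *: wedge a b.
Proof.
apply/ffunP => W; rewrite !ffunE /GRing.scale /= mulr_sumr.
apply: eq_bigr => S _; rewrite !ffunE /GRing.scale /=.
by rewrite [a S * _]mulrCA [LHS]mulrCA.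
Qed.

Lemma wedgeNl a b : wedge (- a) b = - wedge a b.
Proof. by rewrite -scaleN1r wedgeZl scaleN1r. Qed.

Lemma wedgeNr a b : wedge a (- b) = - wedge a b.
Proof. by rewrite -scaleN1r wedgeZr scaleN1r. Qed.

Lemma wedge_suml (I : Type) (r : seq I) (P : pred I) (f : I -> E) b :
  wedge (\sum_(i <- r | P i) f i) b = \sum_(i <- r | P i) wedge (f i) b.
Proof.
apply: (big_morph (fun x => wedge x b)) => [x y|]; first exact: wedgeDl.
by apply: (@addrI E (wedge 0 b)); rewrite -wedgeDl !addr0.
Qed.

Lemma wedge_sumr (I : Type) (r : seq I) (P : pred I) (f : I -> E) b :
  wedge b (\sum_(i <- r | P i) f i) = \sum_(i <- r | P i) wedge b (f i).
Proof.
apply: (big_morph (fun x => wedge b x)) => [x y|]; first exact: wedgeDr.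
by apply: (@addrI E (wedge b 0)); rewrite -wedgeDr !addr0.
Qed.

Lemma inversionsUl S T U : [disjoint S & T] ->
  inversions (S :|: T) U = (inversions S U + inversions T U)%N.
Proof.
move=> dST; rewrite /inversions -(@bigU _ _ _ _ _ _ _ dST).
by apply: eq_bigl => i; rewrite !inE.
Qed.

Lemma inversionsUr S T U : [disjoint T & U] ->
  inversions S (T :|: U) = (inversions S T + inversions S U)%N.
Proof.
move=> dTU; rewrite /inversions -big_split /=; apply: eq_bigr => i _.
by rewrite -(@bigU _ _ _ _ _ _ _ dTU); apply: eq_bigl => j; rewrite !inE.
Qed.

Lemma wedgeA a b c : wedge a (wedge b c) = wedge (wedge a b) c.
Proof.
apply/ffunP => W; rewrite !ffunE.
under [RHS]eq_bigr => S _ do rewrite ffunE mulr_suml mulr_sumr.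
rewrite (exchange_big_dep (fun T => T \subset W)) /=; last first.
  by move=> S T SW TS; apply: subset_trans SW.
apply: eq_bigr => T TW; rewrite ffunE !mulr_sumr.
rewrite [RHS](reindex_onto (fun U => T :|: U) (fun S => S :\: T)) /=; last first.
  move=> S /andP[_ TS]; apply/setP => x; rewrite !inE.
  by case xT: (x \in T) => //=; rewrite (subsetP TS).
apply: eq_big => [U|U].
  rewrite subUset TW subsetUl andbT /= setDUl setDv set0U subsetD.
  by congr (_ && _); apply/idP/eqP => [/setDidPl //|/setDidPl].
rewrite subsetD => /andP[UW dUT].
have dTU : [disjoint T & U] by rewrite disjoint_sym.
have -> : (T :|: U) :\: T = U by rewrite setDUl setDv set0U; apply/setDidPl.
have -> : W :\: T = U :|: (W :\: (T :|: U)).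
  apply/setP => x; rewrite !inE; case xU: (x \in U) => /=.
    by rewrite (subsetP UW) // (disjointFr dUT).
  by rewrite orbF.
set V := W :\: _.
have dUV : [disjoint U & V].
  by rewrite disjoint_sym disjoints_subset /V setDE subIset // setCS subsetUr orbT.
have dTV : [disjoint T & V].
  by rewrite disjoint_sym disjoints_subset /V setDE subIset // setCS subsetUl orbT.
have -> : (U :|: V) :\: U = V.
  by rewrite setDUl setDv set0U; apply/setDidPl; rewrite disjoint_sym.
rewrite inversionsUl // inversionsUr // !exprD; ring.
Qed.

Lemma wedge1r a : wedge a (ext_one F n) = a.
Proof.
apply/ffunP => W; rewrite ffunE (bigD1 W) //= big1 => [|S /andP[SW nSW]].
  rewrite setDv ffunE cards0 eqxx mulr1 addr0.
  by rewrite /inversions big1 ?expr0 ?mul1r // => i _; rewrite big_set0.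
rewrite ffunE cards_eq0 setD_eq0; case: eqVneq nSW => [->|]; rewrite ?eqxx // => nSW _.
suff -> : (W \subset S) = false by rewrite !mulr0.
by apply: contraNF nSW => WS; rewrite eqEsubset SW.
Qed.

Lemma wedge_genl (i : 'I_n) a W : wedge (gen F i) a W =
  if i \in W then (-1) ^+ (\sum_(j in W :\ i) (j < i)%N) * a (W :\ i) else 0.
Proof.
rewrite ffunE; case: ifPn => iW; last first.
  rewrite big1 // => S SW; rewrite ffunE; case: eqVneq => [Si|_].
    by rewrite Si sub1set (negPf iW) in SW.
  by rewrite mul0r mulr0.
rewrite (bigD1 [set i]) ?sub1set //= big1 ?addr0 => [|S /andP[_ nS]].
  by rewrite ffunE eqxx mul1r /inversions big_set1.
by rewrite ffunE (negPf nS) mul0r mulr0.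
Qed.

Lemma gen_anticomm (i j : 'I_n) :
  wedge (gen F i) (gen F j) = - wedge (gen F j) (gen F i).
Proof.
apply/ffunP => W; rewrite [RHS]ffunE !wedge_genl !ffunE.
case: (eqVneq W [set i; j]) => [->|nW]; last first.
  have nWD k l : [set k; l] = [set i; j] -> k \in W ->
      (W :\ k == [set l]) = false.
    move=> kl kW; apply: contraNF nW => /eqP Wk; apply/eqP.
    by rewrite -(setD1K kW) Wk -kl.
  case: ifP => iW; case: ifP => jW; rewrite ?nWD ?mulr0 ?oppr0 //;
    by rewrite setUC.
rewrite !inE !eqxx orbT /=; case: (eqVneq i j) => [<-|nij].
  have -> : [set i; i] :\ i == [set i] = false.
    by apply/negP => /eqP/setP/(_ i); rewrite !inE eqxx.
  by rewrite !mulr0 oppr0.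
have -> : [set i; j] :\ i = [set j].
  by apply/setP => x; rewrite !inE; case: eqVneq => // ->; rewrite (negPf nij).
have -> : [set i; j] :\ j = [set i].
  apply/setP => x; rewrite !inE; case: (eqVneq x j) => [->|]; last by rewrite orbF.
  by rewrite eq_sym (negPf nij).
rewrite !eqxx !big_set1 !mulr1.
have [ij|ji|/val_inj eij] := ltngtP i j; rewrite ?expr0 ?expr1 ?opprK //.
by rewrite eij eqxx in nij.
Qed.

(** The product e_(i_1) /\ ... /\ e_(i_k) of basis 1-forms, for an arbitrary
    list of indices. *)
Definition wedge_gens (s : seq 'I_n) : E := wedges ([seq gen F i | i <- s]).

(** The coefficient of [wedge_gens s] at the set of the entries of [t], for a
    duplicate-free [t], in a form that computes: each leading factor e_i must
    occur in [t], and contributes a sign for the entries of [t] below i. *)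
Fixpoint wedge_gens_coef (s t : seq 'I_n) : int :=
  if s is i :: s' then
    if i \in t then
      (if odd (count (fun j : 'I_n => (j < i)%N) t) then -1 else 1) *
      wedge_gens_coef s' (rem i t)
    else 0
  else (t == [::])%:R.

Lemma wedge_gens_coefE s t : uniq t ->
  wedge_gens s [set x in t] = (wedge_gens_coef s t)%:~R.
Proof.
elim: s t => [|i s IH] t ut; rewrite /wedge_gens /=.
  rewrite ffunE cards_eq0; case: t ut => [|x t] _ /=.
    by rewrite (_ : [set x in [::]] == set0) ?mulr1n //;
      apply/eqP/setP => x; rewrite !inE.
  suff -> : ([set x0 in x :: t] == set0) = false by [].
  by apply/negP => /eqP/setP/(_ x); rewrite !inE eqxx.
rewrite wedge_genl inE; case: ifP => it //.
rewrite intrM -IH ?rem_uniq //= -/(wedge_gens s).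
have -> : [set x in t] :\ i = [set x in rem i t].
  by apply/setP => x; rewrite !inE rem_filter // mem_filter.
congr (_ * _); under eq_bigl => j do rewrite inE.
rewrite -(big_uniq _ (rem_uniq i ut)).
have -> : (\sum_(j <- rem i t) (j < i)%N)%N = count (fun j : 'I_n => (j < i)%N) t.
  have /permP -> := perm_to_rem it; rewrite /= ltnn add0n.
  by elim: (rem i t) => [|x r IHr]; rewrite ?big_nil //= big_cons IHr.
by rewrite -signr_odd; case: odd.
Qed.

Lemma wedge_gens4 (i j k l : 'I_n) :
  wedge (wedge (gen F i) (gen F j)) (wedge (gen F k) (gen F l)) =
  wedge_gens [:: i; j; k; l].
Proof. by rewrite /wedge_gens /= wedge1r -!wedgeA. Qed.

(** Linear combinations of the basis 1-forms. *)
Definition one_form a := exists phi : 'rV[F]_n, a = ext_of_row phi.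

Lemma one_form_gen i : one_form (gen F i).
Proof.
exists (delta_mx 0 i); rewrite /ext_of_row (bigD1 i) //= mxE !eqxx scale1r.
by rewrite big1 ?addr0 // => j ji; rewrite mxE (negPf ji) andbF scale0r.
Qed.

Lemma wedge_row (phi psi : 'rV[F]_n) :
  wedge (ext_of_row phi) (ext_of_row psi) =
  \sum_i \sum_j (phi 0 i * psi 0 j) *: wedge (gen F i) (gen F j).
Proof.
rewrite /ext_of_row wedge_suml; apply: eq_bigr => i _.
rewrite wedgeZl wedge_sumr scaler_sumr; apply: eq_bigr => j _.
by rewrite wedgeZr scalerA.
Qed.

Lemma one_form_anticomm a b : one_form a -> one_form b ->
  wedge a b = - wedge b a.
Proof.
move=> [phi ->] [psi ->]; rewrite !wedge_row exchange_big /= -sumrN.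
apply: eq_bigr => i _; rewrite -sumrN; apply: eq_bigr => j _.
by rewrite gen_anticomm scalerN mulrC.
Qed.

Lemma two_form_comm a b c d : one_form a -> one_form b -> one_form c ->
  one_form d -> wedge (wedge a b) (wedge c d) = wedge (wedge c d) (wedge a b).
Proof.
move=> ha hb hc hd; rewrite -!wedgeA.
rewrite (wedgeA b) (one_form_anticomm hb hc) wedgeNl wedgeNr -wedgeA.
rewrite (one_form_anticomm hb hd) !wedgeNr opprK.
rewrite (wedgeA a) (one_form_anticomm ha hc) wedgeNl -wedgeA.
by rewrite (wedgeA a) (one_form_anticomm ha hd) wedgeNl wedgeNr opprK -wedgeA.
Qed.

End WedgeAlgebra.

(** * The six products of omega_1, omega_sigma, omega_2 *)

Section SixProducts.
Variable F : numFieldType.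
Local Notation E := (ext F (4 + 4)).
Local Notation w1 := (omega1 F).
Local Notation w2 := (omega2 F).
Local Notation ws := (omega_sigma F).

(** The 2-form given by a list of terms c e_i /\ e_j with integral c. *)
Definition form2 (n : nat) (l : seq (int * 'I_n * 'I_n)) : ext F n :=
  \sum_(t <- l) t.1.1%:~R *: wedge (gen F t.1.2) (gen F t.2).

(** The coefficients of a product of two such 2-forms, as computable
    integers. *)
Definition form2_coef (n : nat) (l l' : seq (int * 'I_n * 'I_n)) (s : seq 'I_n) :
    int :=
  foldr (fun t x => foldr (fun u y =>
    t.1.1 * u.1.1 * wedge_gens_coef [:: t.1.2; t.2; u.1.2; u.2] s + y) 0 l' + x) 0 l.

Lemma form2_wedge_coef n (l l' : seq (int * 'I_n * 'I_n)) s : uniq s ->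
  wedge (form2 l) (form2 l') [set x in s] = (form2_coef l l' s)%:~R.
Proof.
move=> us; rewrite /form2 wedge_suml sum_ffunE.
elim: l => [|t l IH] /=; first by rewrite big_nil.
rewrite big_cons IH intrD; congr (_ + _); rewrite {IH l}.
rewrite wedgeZl wedge_sumr ffunE sum_ffunE /GRing.scale /=.
elim: l' => [|u l' IH] /=; first by rewrite big_nil mulr0.
rewrite big_cons mulrDr IH intrD; congr (_ + _).
by rewrite wedgeZr ffunE /GRing.scale /= mulrA wedge_gens4 wedge_gens_coefE // !intrM.
Qed.

Let x0 : 'I_(4+4) := lshift 4 0.
Let x1 : 'I_(4+4) := lshift 4 1.
Let x2 : 'I_(4+4) := lshift 4 2.
Let x3 : 'I_(4+4) := lshift 4 3.
Let y0 : 'I_(4+4) := rshift 4 0.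
Let y1 : 'I_(4+4) := rshift 4 1.
Let y2 : 'I_(4+4) := rshift 4 2.
Let y3 : 'I_(4+4) := rshift 4 3.

Let l1 := [:: (1%:Z, x0, x1); (1%:Z, x2, x3)].
Let l2 := [:: (1%:Z, y0, y1); (1%:Z, y2, y3)].
Let ls := [:: (1%:Z, x0, y1); (-1, x1, y0); (1%:Z, x2, y3); (-1, x3, y2)].

Let w1E : w1 = form2 l1.
Proof. by rewrite /form2 !big_cons big_nil /= !scale1r addr0. Qed.
Let w2E : w2 = form2 l2.
Proof. by rewrite /form2 !big_cons big_nil /= !scale1r addr0. Qed.
Let wsE : ws = form2 ls.
Proof.
by rewrite /form2 !big_cons big_nil /= !rmorphN !scaleN1r !scale1r addr0 !addrA.
Qed.

Lemma form2_comm n (l l' : seq (int * 'I_n * 'I_n)) :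
  wedge (form2 l) (form2 l') = wedge (form2 l') (form2 l).
Proof.
rewrite /form2 !wedge_suml; under eq_bigr => t _ do rewrite wedge_sumr.
rewrite exchange_big /=; apply: eq_bigr => t _; rewrite wedge_sumr.
apply: eq_bigr => u _; rewrite !wedgeZl !wedgeZr !scalerA mulrC.
by congr (_ *: _); apply: two_form_comm; apply: one_form_gen.
Qed.

Lemma omega12C : wedge w2 w1 = wedge w1 w2.
Proof. by rewrite w1E w2E form2_comm. Qed.
Lemma omega1sC : wedge ws w1 = wedge w1 ws.
Proof. by rewrite w1E wsE form2_comm. Qed.
Lemma omega2sC : wedge ws w2 = wedge w2 ws.
Proof. by rewrite w2E wsE form2_comm. Qed.

(** The basis omega_1^2, omega_1 omega_2, omega_2^2, omega_1 omega_sigma,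
    omega_2 omega_sigma, omega_sigma^2; all vectors of six coordinates below are
    in this order. *)
Definition sixprod : 6.-tuple E :=
  [tuple wedge w1 w1; wedge w1 w2; wedge w2 w2;
         wedge w1 ws; wedge w2 ws; wedge ws ws].

(** The class with given coordinates on the six products. *)
Definition Psi (m : 'I_6 -> F) : E := \sum_(j < 6) m j *: sixprod`_j.

(** The coordinates of the square of p omega_1 + q omega_sigma + r omega_2.  The
    ring of coefficients is arbitrary, so that the same formula serves for
    scalars, for curves and for polynomial parametrisations. *)
Definition sq_coef (S : comNzRingType) (p q r : S) (j : 'I_6) : S :=
  [:: p ^+ 2; 2 * p * r; r ^+ 2; 2 * p * q; 2 * r * q; q ^+ 2]`_j.

(** The coordinates of a omega_v^2 + b omega_u^2 + c omega_(v,u)^2, the general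
    element of B^2_K for K with eigenvectors v and u. *)
Definition pencil_coef (S : comNzRingType) (v0 v1 u0 u1 a b c : S) (j : 'I_6) : S :=
  a * sq_coef (v0 ^+ 2) (v0 * v1) (v1 ^+ 2) j +
  b * sq_coef (u0 ^+ 2) (u0 * u1) (u1 ^+ 2) j +
  c * sq_coef (2 * v0 * u0) (v0 * u1 + u0 * v1) (2 * v1 * u1) j.

(** The class p omega_1 + q omega_sigma + r omega_2. *)
Definition lin3 (p q r : F) : E := p *: w1 + q *: ws + r *: w2.

Lemma sum_ord6 (V : nmodType) (f : 'I_6 -> V) : \sum_(j < 6) f j =
  f 0 + f 1 + f 2%:R + f 3%:R + f 4%:R + f 5%:R.
Proof.
rewrite !big_ord_recl big_ord0 addr0 !addrA.
by do ! [congr (_ + _)]; congr f; apply: val_inj.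
Qed.

Lemma PsiE m : Psi m =
  m 0 *: wedge w1 w1 + m 1 *: wedge w1 w2 + m 2%:R *: wedge w2 w2 +
  m 3%:R *: wedge w1 ws + m 4%:R *: wedge w2 ws + m 5%:R *: wedge ws ws.
Proof. exact: sum_ord6. Qed.

Lemma wedge_lin3 p q r p' q' r' : wedge (lin3 p q r) (lin3 p' q' r') =
  Psi (fun j => [:: p * p'; p * r' + r * p'; r * r'; p * q' + q * p';
                    r * q' + q * r'; q * q']`_j).
Proof.
rewrite PsiE /lin3 /=; move: omega12C omega1sC omega2sC.
move: w1 w2 ws => u v w vu wu wv.
rewrite !wedgeDl !wedgeDr !wedgeZl !wedgeZr vu wu wv !scalerA !scalerDl.
move: (wedge u u) (wedge u v) (wedge v v) (wedge u w) (wedge v w)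
  (wedge w w) => a b c d e f; clear.
apply/ffunP => W; rewrite !ffunE /GRing.scale /=; ring.
Qed.

Lemma eq_Psi m m' : m =1 m' -> Psi m = Psi m'.
Proof. by move=> mm; apply: eq_bigr => j _; rewrite mm. Qed.

Lemma lin3_comb (a b c : F) p q r p' q' r' p'' q'' r'' :
  a *: lin3 p q r + b *: lin3 p' q' r' + c *: lin3 p'' q'' r'' =
  lin3 (a * p + b * p' + c * p'') (a * q + b * q' + c * q'')
       (a * r + b * r' + c * r'').
Proof.
rewrite /lin3; move: w1 w2 ws => x y z.
by apply/ffunP => W; rewrite !ffunE /GRing.scale /=; ring.
Qed.

Lemma lin3C p q r p' q' r' :
  wedge (lin3 p q r) (lin3 p' q' r') = wedge (lin3 p' q' r') (lin3 p q r).
Proof.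
rewrite !wedge_lin3; apply: eq_Psi.
by case; do 6 (case; first by move=> ? /=; ring).
Qed.

Lemma sq_lin3 p q r : sq (lin3 p q r) = Psi (sq_coef p q r).
Proof.
rewrite /sq wedge_lin3 !PsiE /sq_coef /=.
move: (wedge w1 w1) (wedge w1 w2) (wedge w2 w2) (wedge w1 ws) (wedge w2 ws)
  (wedge ws ws) => a b c d e f; clear.
apply/ffunP => W; rewrite !ffunE /GRing.scale /=; ring.
Qed.

Lemma PsiD m m' : Psi m + Psi m' = Psi (fun j => m j + m' j).
Proof. by rewrite /Psi -big_split; apply: eq_bigr => j _; rewrite scalerDl. Qed.

Lemma PsiZ k m : k *: Psi m = Psi (fun j => k * m j).
Proof. by rewrite /Psi scaler_sumr; apply: eq_bigr => j _; rewrite scalerA. Qed.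

Lemma omega_vec_lin3 (v : 'cV[F]_2) :
  omega_vec v = lin3 (v 0 0 ^+ 2) (v 0 0 * v 1 0) (v 1 0 ^+ 2).
Proof. by []. Qed.

Lemma omega_pair_lin3 (v u : 'cV[F]_2) :
  omega_pair v u = lin3 (2 * v 0 0 * u 0 0) (v 0 0 * u 1 0 + u 0 0 * v 1 0)
                        (2 * v 1 0 * u 1 0).
Proof. by []. Qed.

Lemma pencil_coef_Psi (v u : 'cV[F]_2) (a b c : F) :
  a *: sq (omega_vec v) + b *: sq (omega_vec u) + c *: sq (omega_pair v u) =
  Psi (pencil_coef (v 0 0) (v 1 0) (u 0 0) (u 1 0) a b c).
Proof. by rewrite !sq_lin3 !PsiZ !PsiD. Qed.

Lemma mem_B2K (v u : 'cV[F]_2) x : x \in B2K v u <-> exists a b c : F,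
  x = Psi (pencil_coef (v 0 0) (v 1 0) (u 0 0) (u 1 0) a b c).
Proof.
rewrite /B2K !span_cons span_nil addv0; split.
  case/memv_addP => _ /vlineP[c ->] [_ /memv_addP[_ /vlineP[a ->] [_ /vlineP[b ->] ->]] ->].
  by exists a, b, c; rewrite -pencil_coef_Psi addrC.
case=> a [b [c ->]]; rewrite -pencil_coef_Psi addrC.
by do ! apply: memv_add; rewrite memvZ ?memv_line.
Qed.

Lemma sq_omega_pair_B2K (v u : 'cV[F]_2) : sq (omega_pair v u) \in B2K v u.
Proof. by rewrite memv_span // mem_head. Qed.

Lemma sq_omega_vec_B2K (v u : 'cV[F]_2) : sq (omega_vec v) \in B2K v u.
Proof. by rewrite memv_span // in_cons mem_head orbT. Qed.

(* The six products are separated by their coefficients at these six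
   increasing sequences of indices. *)
Let test : seq (seq 'I_(4+4)) :=
  [:: [:: x0; x1; x2; x3]; [:: x0; x1; y2; y3]; [:: y0; y1; y2; y3];
      [:: x0; x1; x2; y3]; [:: x0; y1; y2; y3]; [:: x0; x2; y1; y3]].

Let pairs := [:: (l1, l1); (l1, l2); (l2, l2); (l1, ls); (l2, ls); (ls, ls)].

Let sixprod_pairs (j : 'I_6) : sixprod`_j =
  wedge (form2 (nth ([::], [::]) pairs j).1) (form2 (nth ([::], [::]) pairs j).2).
Proof.
by case: j; do 6 (case; first by rewrite /= ?w1E ?w2E ?wsE).
Qed.

Let sixprod_test (j k : 'I_6) :
  sixprod`_j [set x in nth [::] test k] = [:: 2; 1; 2; 1; 1; -2]`_k *+ (j == k).
Proof.
have ut : uniq (nth [::] test k).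
  move: k; case; do 6 (case; first by vm_compute).
  by [].
rewrite sixprod_pairs form2_wedge_coef //.
have -> : form2_coef (nth ([::], [::]) pairs j).1 (nth ([::], [::]) pairs j).2
    (nth [::] test k) = [:: 2%:Z; 1; 2%:Z; 1; 1; -2%:Z]`_k *+ (j == k).
  apply/eqP; move: j k {ut}; case; do 6 (case; first by
    move=> ?; case; do 6 (case; first by move=> ?; vm_compute)).
  by [].
case: eqP => // _; move: k {ut}; case; do 6 (case; first by []).
by [].
Qed.

Lemma Psi_eq0 m : Psi m = 0 -> forall k, m k = 0.
Proof.
move=> /ffunP m0 k; have := m0 [set x in nth [::] test k].
rewrite sum_ffunE (bigD1 k) //= big1 ?addr0 => [|j jk].
  rewrite !ffunE sixprod_test eqxx mulr1n /GRing.scale /= => /eqP.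
  rewrite mulf_eq0 => /orP[/eqP //|]; case: k => k hk /=.
  by do 6 (case: k hk => [|k] hk /=;
    first by rewrite ?oppr_eq0 ?oner_eq0 ?pnatr_eq0).
by rewrite ffunE sixprod_test (negPf jk) mulr0n scaler0.
Qed.

Lemma Psi_inj m m' : Psi m = Psi m' -> m =1 m'.
Proof.
move=> mm k; apply/eqP; rewrite -subr_eq0; apply/eqP.
apply: (@Psi_eq0 (fun k => m k - m' k)).
have -> : Psi (fun k => m k - m' k) = Psi m + (-1) *: Psi m'.
  by rewrite PsiZ PsiD; apply: eq_Psi => j; rewrite mulN1r.
by rewrite mm scaleN1r subrr.
Qed.

Lemma sixprod_free : free sixprod.
Proof. by apply/freeP => m /Psi_eq0. Qed.
End SixProducts.

(** * Hodge classes on J^2 *)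

Section Complexify.
Variable R : realType.
Local Notation C := R[i].
Variable n : nat.
Local Notation cx := (@complexify R n).

Lemma complexifyD a b : cx (a + b) = cx a + cx b.
Proof. by apply/ffunP => S; rewrite !ffunE rmorphD. Qed.

Lemma complexifyZ k a : cx (k *: a) = ratr k *: cx a.
Proof. by apply/ffunP => S; rewrite !ffunE rmorphM. Qed.

Lemma complexify_comb k l a b :
  cx (k *: a + l *: b) = ratr k *: cx a + ratr l *: cx b.
Proof. by rewrite complexifyD !complexifyZ. Qed.

Lemma complexifyB a b : cx (a - b) = cx a - cx b.
Proof. by apply/ffunP => S; rewrite !ffunE rmorphB. Qed.

Lemma complexify0 : cx 0 = 0.
Proof. by apply/ffunP => S; rewrite !ffunE rmorph0. Qed.

Lemma complexify_sum (I : Type) (r : seq I) (P : pred I) f :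
  cx (\sum_(i <- r | P i) f i) = \sum_(i <- r | P i) cx (f i).
Proof. exact: (big_morph cx complexifyD complexify0). Qed.

Lemma complexify_wedge a b : cx (wedge a b) = wedge (cx a) (cx b).
Proof.
apply/ffunP => S; rewrite !ffunE rmorph_sum; apply: eq_bigr => T _.
by rewrite !ffunE !rmorphM rmorphXn rmorphN1.
Qed.

Lemma complexify_gen i : cx (gen rat i) = gen C i.
Proof. by apply/ffunP => S; rewrite !ffunE ratr_nat. Qed.

Lemma complexify_inj : injective cx.
Proof.
move=> a b /ffunP ab; apply/ffunP => S; have := ab S; rewrite !ffunE.
exact: fmorph_inj.
Qed.
End Complexify.

Section HodgeOmega.
Variables (R : realType) (J : abelian_surface R).
Local Notation C := R[i].
Local Notation E := (ext C (4 + 4)).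

Let N : 'M[C]_4 := I_C (cplx J).
Let N2 : I_C (cplx2 J) = block_mx N 0 0 N.
Proof. by rewrite /I_C /cplx2 map_block_mx !map_mx0. Qed.

Let NN : N *m N = (-1)%:M.
Proof. by rewrite /N /I_C -map_mxM cplx_sqr map_scalar_mx rmorphN1. Qed.

Let Om : 'M[C]_4 := Omega C.
Let NON : N^T *m Om *m N = Om.
Proof.
have -> : Om = map_mx (real_complex R) (Omega R).
  by rewrite /Om /Omega !(map_mxD, map_mxN, map_delta_mx).
by rewrite /N /I_C map_trmx -!map_mxM ample_compatible.
Qed.

(* The projections of H^1(J, C) onto H^(1,0) and H^(0,1), acting on rows. *)
Let P10 : 'M[C]_4 := 2^-1 *: (1%:M - 'i *: N).
Let P01 : 'M[C]_4 := 2^-1 *: (1%:M + 'i *: N).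

Let P_sum : P10 + P01 = 1%:M.
Proof.
rewrite /P10 /P01 -scalerDr addrACA addNr addr0 scalerDr -scalerDl.
by rewrite -[2^-1]mul1r -splitr scale1r.
Qed.

Let P10N : P10 *m N = 'i *: P10.
Proof.
rewrite /P10 -scalemxAl mulmxBl mul1mx -scalemxAl NN scalerA mulrC -scalerA.
congr (_ *: _); rewrite scalerBr scalerA -expr2 sqrCi scaleN1r opprK addrC.
by rewrite -scalerN -scaleN1r scale_scalar_mx mulrN1 opprK scalemx1.
Qed.

Let P01N : P01 *m N = (- 'i) *: P01.
Proof.
rewrite /P01 -scalemxAl mulmxDl mul1mx -scalemxAl NN scalerA mulrC -scalerA.
congr (_ *: _); rewrite scalerDr scalerA mulNr -expr2 sqrCi opprK scale1r addrC.
by rewrite !scale_scalar_mx mulrN1 mulr1.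
Qed.

Let skew : N^T *m Om + Om *m N = 0.
Proof.
have : N^T *m Om *m N *m N = Om *m N by rewrite NON.
by rewrite -mulmxA NN mul_mx_scalar scaleN1r => <-; rewrite subrr.
Qed.

Let conj_Om (c : C) : c ^+ 2 = -1 ->
  (2^-1 *: (1%:M + c *: N))^T *m Om *m (2^-1 *: (1%:M + c *: N)) = 0.
Proof.
have tZ k (A : 'M[C]_4) : (k *: A)^T = k *: A^T by rewrite linearZ.
have tD (A B : 'M[C]_4) : (A + B)^T = A^T + B^T by rewrite linearD.
move=> c2; suff H : (1%:M + c *: N)^T *m Om *m (1%:M + c *: N) = 0.
  by rewrite tZ -!scalemxAl -scalemxAr H !scaler0.
rewrite tD tZ trmx1 mulmxDl mul1mx mulmxDr mulmx1 mulmxDl.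
rewrite -!scalemxAl -!scalemxAr NON scalerA -expr2 c2 scaleN1r.
by rewrite [X in _ + X]addrC addrACA subrr add0r -scalerDr skew scaler0.
Qed.

Let P10_Om : P10^T *m Om *m P10 = 0.
Proof. by rewrite /P10 -scaleNr conj_Om // sqrrN sqrCi. Qed.

Let P01_Om : P01^T *m Om *m P01 = 0.
Proof. by rewrite /P01 conj_Om // sqrCi. Qed.

Let Om_split : Om = P10^T *m Om *m P01 + P01^T *m Om *m P10.
Proof.
move: P_sum P10_Om P01_Om; move: (Om) (P10) (P01) => O A B AB hA hB.
transitivity ((A + B)^T *m O *m (A + B)).
  by rewrite AB trmx1 mul1mx mulmx1.
have -> : (A + B)^T = A^T + B^T by rewrite linearD.
by rewrite !mulmxDl !mulmxDr hA hB add0r addr0.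
Qed.

(* The embedding of H^1 of the first (false) or second (true) factor J. *)
Let emb (s : bool) (phi : 'rV[C]_4) : 'rV[C]_(4 + 4) :=
  if s then row_mx 0 phi else row_mx phi 0.

Let ge (s : bool) (i : 'I_4) : E :=
  gen C (if s then rshift 4 i else lshift 4 i).

Let emb_row s phi : ext_of_row (emb s phi) = \sum_i phi 0 i *: ge s i.
Proof.
rewrite /ext_of_row big_split_ord /= /emb /ge; case: s.
  rewrite [X in X + _]big1; last by move=> i _; rewrite row_mxEl mxE scale0r.
  by rewrite [LHS]add0r; apply: eq_bigr => i _; rewrite row_mxEr.
rewrite [X in _ + X]big1; last by move=> i _; rewrite row_mxEr mxE scale0r.
by rewrite [LHS]addr0; apply: eq_bigr => i _; rewrite row_mxEl.
Qed.

(* The 2-form with matrix A in the 1-forms of the factors s and t. *)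
Let bil (s t : bool) (A : 'M[C]_4) : E :=
  \sum_i \sum_j A i j *: wedge (ge s i) (ge t j).

Let bilD s t A B : bil s t (A + B) = bil s t A + bil s t B.
Proof.
rewrite /bil -big_split; apply: eq_bigr => i _; rewrite -big_split.
by apply: eq_bigr => j _; rewrite mxE scalerDl.
Qed.

Let bil_sum s t (I : finType) (A : I -> 'M[C]_4) :
  bil s t (\sum_k A k) = \sum_k bil s t (A k).
Proof.
apply: (big_morph (bil s t) (bilD s t)); rewrite /bil big1 // => i _.
by rewrite big1 // => j _; rewrite mxE scale0r.
Qed.

Let bil_wedge s t (phi psi : 'rV[C]_4) :
  bil s t (phi^T *m psi) = wedge (ext_of_row (emb s phi)) (ext_of_row (emb t psi)).
Proof.
rewrite !emb_row wedge_suml; apply: eq_bigr => i _.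
rewrite wedgeZl wedge_sumr scaler_sumr; apply: eq_bigr => j _.
by rewrite wedgeZr scalerA mxE big_ord1 mxE.
Qed.

Let bil_mul s t (P Q : 'M[C]_4) : bil s t (P^T *m Om *m Q) =
  \sum_(k : 'I_4 * 'I_4) wedge (ext_of_row (emb s (row k.1 P)))
    (ext_of_row (emb t (Om k.1 k.2 *: row k.2 Q))).
Proof.
transitivity (bil s t (\sum_(k : 'I_4 * 'I_4)
    (row k.1 P)^T *m (Om k.1 k.2 *: row k.2 Q))); last first.
  by rewrite bil_sum; apply: eq_bigr => k _; rewrite bil_wedge.
congr bil; apply/matrixP => i j; rewrite summxE -mulmxA mxE.
rewrite -(pair_bigA _ (fun k l => ((row k P)^T *m (Om k l *: row l Q)) i j)) /=.
apply: eq_bigr => k _; rewrite !mxE mulr_sumr; apply: eq_bigr => l _.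
by rewrite [RHS]mxE big_ord1; congr (_ * _); rewrite !mxE.
Qed.

Let emb_eigen s phi (c : C) : phi *m N = c *: phi ->
  emb s phi *m I_C (cplx2 J) = c *: emb s phi.
Proof.
move=> h; rewrite N2 /emb; case: s; rewrite mul_row_block !mul0mx !mulmx0;
  by rewrite ?add0r ?addr0 h scale_row_mx scaler0.
Qed.

(* The forms of type (1, 1), as explicit sums of products. *)
Let is11 (x : E) := exists (I : finType) (a b : I -> E),
  [/\ forall k, H10 (cplx2 J) (a k), forall k, H01 (cplx2 J) (b k) &
      x = \sum_k wedge (a k) (b k)].

Let H10_one x : H10 (cplx2 J) x -> one_form x.
Proof. by case=> phi _ ->; exists phi. Qed.
Let H01_one x : H01 (cplx2 J) x -> one_form x.
Proof. by case=> phi _ ->; exists phi. Qed.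

Let is11D x y : is11 x -> is11 y -> is11 (x + y).
Proof.
move=> [I [a [b [ha hb ->]]]] [I' [a' [b' [ha' hb' ->]]]].
exists (I + I')%type, (fun k => match k with inl i => a i | inr i => a' i end),
  (fun k => match k with inl i => b i | inr i => b' i end).
by split=> [[]|[]|] //; rewrite big_sumType.
Qed.

Let is11Z (c : C) x : is11 x -> is11 (c *: x).
Proof.
move=> [I [a [b [ha hb ->]]]]; exists I, (fun k => c *: a k), b; split=> // [k|].
  have [phi h ->] := ha k; exists (c *: phi).
    by rewrite -scalemxAl h !scalerA mulrC.
  by rewrite /ext_of_row scaler_sumr; apply: eq_bigr => j _; rewrite mxE scalerA.
by rewrite scaler_sumr; apply: eq_bigr => k _; rewrite wedgeZl.
Qed.

Let H10_emb s (k : C) i : H10 (cplx2 J) (ext_of_row (emb s (k *: row i P10))).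
Proof.
exists (emb s (k *: row i P10)) => //; apply: emb_eigen.
by rewrite -scalemxAl -row_mul P10N [row _ _]linearZ /= !scalerA mulrC.
Qed.

Let H01_emb s (k : C) i : H01 (cplx2 J) (ext_of_row (emb s (k *: row i P01))).
Proof.
exists (emb s (k *: row i P01)) => //; apply: emb_eigen.
by rewrite -scalemxAl -row_mul P01N [row _ _]linearZ /= !scalerA mulrC.
Qed.

(* For A = Omega the (2, 0) and (0, 2) parts vanish, because the complex
   structure preserves the polarization. *)
Let is11_bil s t : is11 (bil s t Om).
Proof.
rewrite Om_split bilD; apply: is11D; rewrite bil_mul.
  exists ('I_4 * 'I_4)%type, (fun k => ext_of_row (emb s (row k.1 P10))),
    (fun k => ext_of_row (emb t (Om k.1 k.2 *: row k.2 P01))).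
  by split=> // k; rewrite -[row _ _]scale1r; apply: H10_emb.
exists ('I_4 * 'I_4)%type,
    (fun k => ext_of_row (emb t (- Om k.1 k.2 *: row k.2 P10))),
    (fun k => ext_of_row (emb s (row k.1 P01))).
split=> // [k|]; first by rewrite -[row _ _]scale1r; apply: H01_emb.
apply: eq_bigr => k _; rewrite one_form_anticomm; try by eexists.
rewrite -wedgeNl; congr wedge; rewrite !emb_row -sumrN; apply: eq_bigr => i _.
by rewrite !mxE mulNr scaleNr.
Qed.

Let bil_Om s t : bil s t Om =
  wedge (ge s 0) (ge t 1) - wedge (ge s 1) (ge t 0)
  + wedge (ge s 2) (ge t 3) - wedge (ge s 3) (ge t 2).
Proof.
have bilN A : bil s t (- A) = - bil s t A.
  rewrite /bil -sumrN; apply: eq_bigr => i _; rewrite -sumrN.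
  by apply: eq_bigr => j _; rewrite mxE scaleNr.
have bil_delta i j : bil s t (delta_mx i j) = wedge (ge s i) (ge t j).
  rewrite /bil (bigD1 i) //= [X in _ + X]big1 => [|k ki]; last first.
    by rewrite big1 // => l _; rewrite mxE (negPf ki) scale0r.
  rewrite (bigD1 j) //= big1 => [|l lj]; last first.
    by rewrite mxE (negPf lj) andbF scale0r.
  by rewrite mxE !eqxx scale1r !addr0.
by rewrite /Om /Omega !bilD !bilN !bil_delta.
Qed.

Let half2 (x y : E) : 2^-1 *: (x + x + y + y) = x + y.
Proof. by rewrite -addrA !scalerDr -!scalerDl -[2^-1]mul1r -splitr !scale1r. Qed.

Let is11_omega1 : is11 (omega1 C).
Proof.
have := is11Z 2^-1 (is11_bil false false); rewrite bil_Om.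
by rewrite (gen_anticomm _ (lshift 4 1)) (gen_anticomm _ (lshift 4 3)) !opprK half2.
Qed.

Let is11_omega2 : is11 (omega2 C).
Proof.
have := is11Z 2^-1 (is11_bil true true); rewrite bil_Om.
by rewrite (gen_anticomm _ (rshift 4 1)) (gen_anticomm _ (rshift 4 3)) !opprK half2.
Qed.

Let is11_omega_sigma : is11 (omega_sigma C).
Proof. by have := is11_bil false true; rewrite bil_Om. Qed.

Let is11_wedge x y : is11 x -> is11 y -> wedge x y \in Hpq (cplx2 J) 2 2.
Proof.
move=> [I [a [b [ha hb ->]]]] [I' [a' [b' [ha' hb' ->]]]].
rewrite wedge_suml; apply: memv_suml => i _.
rewrite wedge_sumr; apply: memv_suml => k _.
have -> : wedge (wedge (a i) (b i)) (wedge (a' k) (b' k)) =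
    - wedges ([:: a i; a' k] ++ [:: b i; b' k]).
  rewrite /= wedge1r -wedgeA (wedgeA (b i)) (@one_form_anticomm _ _ (b i)).
  - by rewrite wedgeNl wedgeNr -wedgeA.
  - exact: H01_one.
  - exact: H10_one.
rewrite memvN; apply: (vspanP _).1.
exists [:: a i; a' k], [:: b i; b' k]; split=> // z; rewrite !inE;
  by case/orP => /eqP ->.
Qed.

Lemma sixprod_Hpq (j : 'I_6) : (sixprod C)`_j \in Hpq (cplx2 J) 2 2.
Proof.
have o1 := is11_omega1; have o2 := is11_omega2; have os := is11_omega_sigma.
move: j; case; case; first by move=> ?; exact: (is11_wedge o1 o1).
case; first by move=> ?; exact: (is11_wedge o1 o2).
case; first by move=> ?; exact: (is11_wedge o2 o2).
case; first by move=> ?; exact: (is11_wedge o1 os).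
case; first by move=> ?; exact: (is11_wedge o2 os).
case; first by move=> ?; exact: (is11_wedge os os).
by [].
Qed.

Lemma complexify_omega1 : complexify R (omega1 rat) = omega1 C.
Proof. by rewrite complexifyD !complexify_wedge !complexify_gen. Qed.

Lemma complexify_omega2 : complexify R (omega2 rat) = omega2 C.
Proof. by rewrite complexifyD !complexify_wedge !complexify_gen. Qed.

Lemma complexify_omega_sigma : complexify R (omega_sigma rat) = omega_sigma C.
Proof.
rewrite complexifyB complexifyD complexifyB.
by rewrite !complexify_wedge !complexify_gen.
Qed.

Lemma complexify_sixprod (j : 'I_6) :
  complexify R (sixprod rat)`_j = (sixprod C)`_j.
Proof.
have o1 := complexify_omega1; have o2 := complexify_omega2.
have os := complexify_omega_sigma.
have w a b a' b' : complexify R a = a' -> complexify R b = b' ->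
    complexify R (wedge a b) = wedge a' b' :> E.
  by move=> <- <-; apply: complexify_wedge.
move: j; case; case; first by move=> ?; exact: (w _ _ _ _ o1 o1).
case; first by move=> ?; exact: (w _ _ _ _ o1 o2).
case; first by move=> ?; exact: (w _ _ _ _ o2 o2).
case; first by move=> ?; exact: (w _ _ _ _ o1 os).
case; first by move=> ?; exact: (w _ _ _ _ o2 os).
case; first by move=> ?; exact: (w _ _ _ _ os os).
by [].
Qed.

Lemma complexify_Psi m : complexify R (Psi m) = Psi (fun j => ratr (m j)).
Proof.
rewrite complexify_sum; apply: eq_bigr => j _.
by rewrite complexifyZ complexify_sixprod.
Qed.

Lemma hodge_class_Psi m : hodge_class_JJ J 2 (Psi m).
Proof.
rewrite /hodge_class_JJ /hodge_class complexify_Psi.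
by apply: memv_suml => j _; rewrite memvZ ?sixprod_Hpq.
Qed.

Lemma hodge_space_mem c : hodge_class_JJ J 2 c -> complexify R c \in B2 J.
Proof. by move=> hc; apply: (vspanP _).1; exists c. Qed.

Lemma sixprod_B2 (j : 'I_6) : (sixprod C)`_j \in B2 J.
Proof.
rewrite -complexify_sixprod; apply: hodge_space_mem.
by rewrite /hodge_class_JJ /hodge_class complexify_sixprod sixprod_Hpq.
Qed.

Lemma Psi_B2 m : Psi m \in B2 J.
Proof. by apply: memv_suml => j _; rewrite memvZ ?sixprod_B2. Qed.

Lemma B2K_sub v u : (B2K v u <= B2 J)%VS.
Proof. by apply/subvP => x /mem_B2K [a [b [c ->]]]; apply: Psi_B2. Qed.
End HodgeOmega.

(** * Chains of irreducible closed subsets of a projective space *)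

Section Curve.
Variable F : numFieldType.

Lemma poly_inf_eq0 (p : {poly F}) : (forall t, p.[t] = 0) -> p = 0.
Proof.
move=> p0; apply/eqP/negPn/negP => pn0.
have := @max_poly_roots _ p [seq i%:R | i <- iota 0 (size p)] pn0.
rewrite size_map size_iota ltnn => /(_ _ _)/negP; apply=> //.
  by apply/allP => x _; rewrite /root p0.
by rewrite map_inj_uniq ?iota_uniq // => i j /eqP; rewrite eqr_nat => /eqP.
Qed.

Lemma poly_gen_eq0 (q p : {poly F}) : q != 0 ->
  (forall t, q.[t] != 0 -> p.[t] = 0) -> p = 0.
Proof.
move=> q0 qp; have /eqP : q * p = 0.
  apply: poly_inf_eq0 => t; rewrite hornerM.
  by have [->|/qp ->] := eqVneq q.[t] 0; rewrite ?mul0r ?mulr0.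
by rewrite mulf_eq0 (negPf q0) => /eqP.
Qed.

Variable n : nat.

(** The restriction of a polynomial to the polynomial curve [g]. *)
Definition curve (g : 'I_n -> {poly F}) (f : {mpoly F[n]}) : {poly F} :=
  mmap (@polyC F) g f.

Lemma curve_horner g f t : (curve g f).[t] = f.@[fun i => (g i).[t]].
Proof.
rewrite mevalE /curve /mmap horner_sum; apply: eq_bigr => m _.
rewrite hornerM hornerC /mmap1 horner_prod; congr (_ * _).
by apply: eq_bigr => i _; rewrite horner_exp.
Qed.

Lemma curveM g f f' : curve g (f * f') = curve g f * curve g f'.
Proof. exact: rmorphM. Qed.

Lemma curve_deriv g f t : (curve g f)^`().[t] =
  \sum_i f^`M(i).@[fun i => (g i).[t]] * (g i)^`().[t].
Proof.
pose D f := (curve g f)^`().[t] =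
  \sum_i f^`M(i).@[fun i => (g i).[t]] * (g i)^`().[t].
have DD p q : D p -> D q -> D (p + q).
  rewrite /D /curve mmapD derivD hornerD => -> ->; rewrite -big_split /=.
  by apply: eq_bigr => i _; rewrite mderivD mevalD mulrDl.
have DM p q : D p -> D q -> D (p * q).
  rewrite /D curveM derivM hornerD !hornerM !curve_horner => -> ->.
  rewrite mulr_suml mulr_sumr -big_split; apply: eq_bigr => i _ /=.
  rewrite mderivM mevalD !mevalM; ring.
have DC c : D c%:MP.
  rewrite /D /curve mmapC derivC horner0 big1 // => i _.
  by rewrite mderivC meval0 mul0r.
have DX i : D 'X_i.
  rewrite /D /curve mmapX mmap1U (bigD1 i) //= big1 => [|j ji].
    rewrite mderivX mnm1E eqxx scale1r.
    have -> : (U_(i) - U_(i))%MM = 0%MM.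
      by apply/mnmP => k; rewrite mnmBE mnm0E subnn.
    by rewrite mpolyX0 meval1 mul1r addr0.
  by rewrite mderivX mnm1E eq_sym (negPf ji) scale0r meval0 mul0r.
change (D f); rewrite [f]mpolyE; elim/big_ind: _ => [||m _]; rewrite -?mpolyC0 //.
rewrite -mul_mpolyC; apply: (DM) => //; rewrite mpolyXE_id.
elim/big_ind: _ => [||i _]; rewrite -?mpolyC1 //.
by elim: (m i) => [|k IH]; rewrite ?expr0 -?mpolyC1 // exprS; apply: DM.
Qed.
End Curve.

Section Projective.
Local Open Scope classical_set_scope.
Variables (F : numFieldType) (V : vectType F) (U : {vspace V}).
Local Notation n := (\dim U).
Local Notation poly := {mpoly F[n]}.
Local Notation P := (proj U).
Local Notation crd := (coord (vbasis U)).
Implicit Types (f g : poly) (L : P) (X Y : set P).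

Lemma proj_gen L : exists x, [/\ x != 0, x \in U & \val L = <[x]>%VS].
Proof.
case: L => L /= /andP[LU /eqP L1].
have L0 : L != 0%VS by rewrite -dimv_eq0 L1.
exists (vpick L); rewrite vpick0 L0; split=> //.
  exact: (subvP LU) (memv_pick L).
by apply/esym/eqP; rewrite eqEdim -memvE memv_pick L1 dim_vline vpick0 L0.
Qed.

(** The restriction of f to the line spanned by x. *)
Definition line_poly (x : V) f : {poly F} := curve (fun i => crd i x *: 'X) f.

Lemma line_polyE x f s : (line_poly x f).[s] = peval f (s *: x).
Proof.
rewrite curve_horner; apply: meval_eq => i.
by rewrite hornerZ hornerX linearZ /= mulrC.
Qed.

Lemma vanishes_line L x f : \val L = <[x]>%VS ->
  vanishes_at f L <-> line_poly x f = 0.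
Proof.
move=> Lx; split=> [fL|f0 y].
  apply: poly_inf_eq0 => s; rewrite line_polyE; apply: fL.
  by rewrite Lx memvZ ?memv_line.
by rewrite Lx => /vlineP[s ->]; rewrite -line_polyE f0 horner0.
Qed.

Lemma vanishes_mul L f g :
  vanishes_at (f * g) L <-> vanishes_at f L \/ vanishes_at g L.
Proof.
have [x [_ _ Lx]] := proj_gen L; rewrite !(vanishes_line _ Lx).
rewrite /line_poly curveM; split=> [/eqP|[|] ->]; rewrite ?mul0r ?mulr0 //.
by rewrite mulf_eq0 => /orP[]/eqP ->; [left|right].
Qed.

Lemma line_poly_homog x f d : f \is d.-homog ->
  line_poly x f = peval f x *: 'X^d.
Proof.
move=> /dhomogP hf; rewrite /line_poly /curve /mmap /peval mevalE scaler_suml.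
rewrite [LHS]big_seq [RHS]big_seq; apply: eq_bigr => m /hf md.
rewrite mul_polyC -scalerA; congr (_ *: _); rewrite /mmap1.
rewrite -md /= mdegE expr_sum -scaler_prod.
by apply: eq_bigr => i _; rewrite exprZn.
Qed.

Lemma line_poly_coef x f d : (line_poly x f)`_d = peval (pihomog mdeg d f) x.
Proof.
pose k := maxn (msize f) d.+1.
have fE : f = \sum_(i < k) pihomog mdeg i f.
  by apply: pihomog_partitionE; rewrite leq_maxl.
have -> : line_poly x f = \sum_(i < k) line_poly x (pihomog mdeg i f).
  by rewrite {1}fE /line_poly /curve raddf_sum.
rewrite coef_sum; have dk : (d < k)%N by rewrite leq_maxr.
rewrite (bigD1 (Ordinal dk)) //= big1 ?addr0 => [|i id].
  by rewrite (line_poly_homog _ (pihomogP _ _ _)) coefZ coefXn eqxx mulr1.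
rewrite (line_poly_homog _ (pihomogP _ _ _)) coefZ coefXn.
by rewrite eq_sym (_ : _ == _ = false) ?mulr0 //; apply: contraNF id => /eqP id;
  apply/eqP/val_inj.
Qed.

(** The zero locus of a polynomial that need not be homogeneous is closed: it is
    cut out by the homogeneous components. *)
Lemma zclosed_vanishing f : zclosed [set L | vanishes_at f L].
Proof.
exists [set g | exists d, g = pihomog mdeg d f].
  by move=> _ [d ->]; exists d; apply: pihomogP.
move=> L; have [x [_ _ Lx]] := proj_gen L; split.
  move=> /(vanishes_line _ Lx) f0 _ [d ->]; apply/(vanishes_line _ Lx).
  by rewrite (line_poly_homog _ (pihomogP _ _ _)) -line_poly_coef f0 coef0 scale0r.
move=> h; apply/(vanishes_line _ Lx)/polyP => d; rewrite line_poly_coef coef0.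
have := h (pihomog mdeg d f); apply; first by exists d.
by rewrite Lx memv_line.
Qed.

(** Membership of f in the ideal of X. *)
Definition vanishes_on X f := forall L, X L -> vanishes_at f L.

(** The ideal of X is prime; no homogeneity is required. *)
Definition vanishing_prime X :=
  forall f g, vanishes_on X (f * g) -> vanishes_on X f \/ vanishes_on X g.

Lemma zirreducible_vanishing_prime X : zirreducible X -> vanishing_prime X.
Proof.
move=> [_ irr] f g fg.
apply: (irr _ _ (zclosed_vanishing f) (zclosed_vanishing g)) => L /fg.
by move=> /vanishes_mul.
Qed.

Lemma vanishes_on_closure X f : vanishes_on X f -> vanishes_on (zclosure X) f.
Proof. by move=> Xf L; apply; [apply: zclosed_vanishing|]. Qed.

Lemma zclosed_proper X Y : zclosed X -> X `<=` Y -> X <> Y ->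
  exists2 g, vanishes_on X g & ~ vanishes_on Y g.
Proof.
move=> [S _ SX] XY nXY; apply: contrapT => h; apply: nXY.
apply/seteqP; split=> // L YL; apply/SX => f Sf.
apply: contrapT => nf; apply: h; exists f; first by move=> L' /SX; apply.
by move/(_ L YL).
Qed.

Lemma vanishes_onB X f g :
  vanishes_on X f -> vanishes_on X g -> vanishes_on X (f - g).
Proof.
move=> hf hg L XL x xL.
by rewrite /peval mevalB -/(peval f x) -/(peval g x) (hf L) ?(hg L) ?subr0.
Qed.

Lemma vanishes_on_mulr X f g : vanishes_on X f -> vanishes_on X (f * g).
Proof.
by move=> hf L XL x xL; rewrite /peval mevalM -/(peval f x) (hf L) ?mul0r.
Qed.

Lemma vanishes_on0 X : vanishes_on X 0.
Proof. by move=> L XL x xL; rewrite /peval meval0. Qed.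

Lemma vanishes_on_sub X Y f : X `<=` Y -> vanishes_on Y f -> vanishes_on X f.
Proof. by move=> XY fY L /XY; apply: fY. Qed.

(** Linear independence of a family modulo the ideal of X. *)
Definition free_mod X (I : finType) (m : I -> poly) :=
  forall c : I -> F, vanishes_on X (\sum_i c i *: m i) -> forall i, c i = 0.

(** If g vanishes on X but not on the irreducible Y containing X, a relation
    sum_b p_b g^b = 0 on Y is trivial, provided that each p_b that vanishes on X
    is zero: restricting to X gives p_0 = 0, and g can be cancelled. *)
Lemma vanishes_on_powers X Y g M (p : nat -> poly) :
  vanishing_prime Y -> X `<=` Y ->
  vanishes_on X g -> ~ vanishes_on Y g ->
  (forall b, (b < M)%N -> vanishes_on X (p b) -> p b = 0) ->
  vanishes_on Y (\sum_(b < M) p b * g ^+ b) -> forall b, (b < M)%N -> p b = 0.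
Proof.
move=> prY XY Xg nYg; elim: M p => // M IH p hp.
rewrite big_ord_recl /= expr0 mulr1.
have -> : \sum_(i < M) p (bump 0 i) * g ^+ bump 0 i =
    g * \sum_(i < M) p i.+1 * g ^+ i.
  by rewrite mulr_sumr; apply: eq_bigr => i _; rewrite exprS mulrCA.
move=> Yp; have p0 : p 0%N = 0.
  apply: hp => //; rewrite -[p 0%N](addrK (g * \sum_(i < M) p i.+1 * g ^+ i)).
  by apply: vanishes_onB; [apply: vanishes_on_sub Yp|apply: vanishes_on_mulr].
rewrite p0 add0r in Yp; have [//|Yr] := prY _ _ Yp.
case=> // b bM; apply: (IH (fun b => p b.+1)) => // b' b'M.
exact: hp.
Qed.

(** One step of the chain multiplies a free family by the powers of g. *)
Lemma free_mod_step X Y g M (I : finType) (m : I -> poly) : vanishing_prime Y ->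
  X `<=` Y -> vanishes_on X g -> ~ vanishes_on Y g -> free_mod X m ->
  free_mod Y (fun k : I * 'I_M => m k.1 * g ^+ k.2).
Proof.
move=> prY XY Xg nYg lm c Yc [i b].
pose p (b : nat) := \sum_i oapp (fun b' : 'I_M => c (i, b')) 0 (insub b) *: m i.
have pE (b' : 'I_M) : p b' = \sum_i c (i, b') *: m i.
  by apply: eq_bigr => j _; rewrite valK.
have p0 : p b = 0.
  apply: (vanishes_on_powers prY XY Xg nYg (M := M)) => // [b' b'M|].
    rewrite (pE (Ordinal b'M)) => /lm c0.
    by rewrite big1 // => j _; rewrite c0 scale0r.
  have -> : \sum_(b < M) p b * g ^+ b = \sum_k c k *: (m k.1 * g ^+ k.2) => //.
  rewrite [RHS](eq_bigr (fun k => c (k.1, k.2) *: (m k.1 * g ^+ k.2))).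
    2: by case.
  rewrite -(pair_bigA _ (fun i b => c (i, b) *: (m i * g ^+ b))) /=.
  rewrite exchange_big /=; apply: eq_bigr => b' _.
  by rewrite pE mulr_suml; apply: eq_bigr => j _; rewrite scalerAl.
have := lm (fun i => c (i, b)); apply; rewrite -pE p0; exact: vanishes_on0.
Qed.

Section Chain.
Variables (k : nat) (phi : {lrmorphism poly -> {mpoly F[k]}}).

Lemma msize_mul (p q : {mpoly F[k]}) a b : (msize p <= a.+1)%N ->
  (msize q <= b.+1)%N -> (msize (p * q) <= (a + b).+1)%N.
Proof.
move=> pa qb; have [->|p0] := eqVneq p 0; first by rewrite mul0r msize0.
have [->|q0] := eqVneq q 0; first by rewrite mulr0 msize0.
rewrite msizeM //; move: pa qb.
by case: (msize p) => [|s]; case: (msize q) => [|t] //=;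
  rewrite ?ltnS ?addnS ?addSn //= => sa tb; rewrite ?ltnS; lia.
Qed.

Lemma msize_exp (p : {mpoly F[k]}) a b : (msize p <= a.+1)%N ->
  (msize (p ^+ b) <= (a * b).+1)%N.
Proof.
move=> pa; elim: b => [|b IH]; first by rewrite expr0 msize1 muln0.
by rewrite exprS mulnS; apply: msize_mul.
Qed.

(** A chain X_0 < ... < X_d of irreducible closed sets carries, for every M, a
    family of M^(d+1) polynomials that is free on X_d and whose images under phi
    have degree at most e M, where e does not depend on M. *)
Lemma chain_free_mod (X : nat -> set P) L d : X 0%N L ->
  (forall i, (i <= d)%N -> zclosed (X i) /\ vanishing_prime (X i)) ->
  (forall i, (i < d)%N -> X i `<=` X i.+1 /\ X i <> X i.+1) ->
  exists e, forall M, exists (I : finType) (m : I -> poly),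
    [/\ #|I| = (M ^ d.+1)%N, forall i, (msize (phi (m i)) <= (e * M).+1)%N &
        free_mod (X d) m].
Proof.
move=> X0L; elim: d => [|d IH] cl ch.
  have [x [x0 xU Lx]] := proj_gen L.
  have [i xi] : exists i, crd i x != 0.
    apply/existsP; apply: contraNT x0; rewrite negb_exists => /forallP x0.
    rewrite (coord_vbasis xU) big1 // => i _; move: (x0 i).
    by rewrite negbK => /eqP ->; rewrite scale0r.
  exists (msize (phi 'X_i)) => M; exists 'I_M, (fun b : 'I_M => 'X_i ^+ b).
  split=> [|b|c Xc b]; first by rewrite card_ord expn1.
    rewrite rmorphXn; apply: leq_trans (_ : (msize (phi 'X_i) * b).+1 <= _)%N.
      by apply: msize_exp.
    by rewrite ltnS leq_mul2l (ltnW (ltn_ord b)) orbT.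
  move/(vanishes_line _ Lx): (Xc L X0L) => /polyP /(_ b).
  rewrite coef0 /line_poly /curve raddf_sum coef_sum /= (bigD1 b) //= big1.
    rewrite addr0 mmapZ rmorphXn /= mmapX mmap1U mul_polyC exprZn coefZ coefZ.
    rewrite coefXn eqxx mulr1 => /eqP; rewrite mulf_eq0 expf_eq0 (negPf xi).
    by rewrite andbF orbF => /eqP.
  move=> b' bb'; rewrite mmapZ rmorphXn /= mmapX mmap1U mul_polyC exprZn !coefZ.
  rewrite coefXn (_ : _ == _ = false) ?mulr0 //.
  by apply: contraNF bb' => /eqP/val_inj ->.
have [] := IH.
- by move=> i id; apply: cl; apply: leqW.
- by move=> i id; apply: ch; apply: leqW.
move=> e he; have [clX _] := cl d (leqnSn d).
have [_ prY] := cl d.+1 (leqnn _); have [XY nXY] := ch d (ltnSn d).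
have [g Xg nYg] := zclosed_proper clX XY nXY.
exists (e + msize (phi g))%N => M; have [I [m [cI sm lm]]] := he M.
exists (I * 'I_M)%type, (fun k : I * 'I_M => m k.1 * g ^+ k.2).
split=> [|[i b]|].
- by rewrite card_prod cI card_ord -expnSr.
- rewrite rmorphM rmorphXn /=.
  apply: leq_trans (_ : (e * M + msize (phi g) * b).+1 <= _)%N.
    by apply: msize_mul => //; apply: msize_exp.
  by rewrite ltnS mulnDl leq_add2l leq_mul2l (ltnW (ltn_ord b)) orbT.
- exact: free_mod_step lm.
Qed.

(** A family of polynomials of degree < D in k variables is linearly dependent
    as soon as it has more than D^k members. *)
Lemma mpoly_dependent (I : finType) (p : I -> {mpoly F[k]}) D :
  (forall i, (msize (p i) <= D)%N) -> (D ^ k < #|I|)%N ->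
  exists2 c : I -> F, (exists i, c i != 0) & \sum_i c i *: p i = 0.
Proof.
move=> sp cI; pose T := {ffun 'I_k -> 'I_D}.
pose mn (t : T) : 'X_{1..k} := [multinom nat_of_ord (t i) | i < k].
pose A := \matrix_(i < #|I|, j < #|{: T}|) (p (enum_val i))@_(mn (enum_val j)).
have : kermx A != 0.
  rewrite kermx_eq0; apply/negP => /eqP rA; move: cI; rewrite -rA ltnNge.
  by move/negP; apply; rewrite (leq_trans (rank_leq_col _)) // card_ffun !card_ord.
case/rowV0Pn => v /sub_kermxP vA v0; exists (fun i => v 0 (enum_rank i)).
  case/rV0Pn: v0 => i vi; exists (enum_val i); by rewrite enum_valK.
apply/mpolyP => m; rewrite mcoeff0 raddf_sum /=.
have [[t ->]|nt] := pselect (exists t, m = mn t); last first.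
  rewrite big1 // => i _; rewrite mcoeffZ memN_msupp_eq0 ?mulr0 //.
  apply: contra_notN nt => mp.
  have mD (j : 'I_k) : (m j < D)%N.
    apply: leq_trans (sp i); apply: leq_ltn_trans (msize_mdeg_lt mp).
    by rewrite mdegE (bigD1 j) //= leq_addr.
  exists [ffun j => Ordinal (mD j)]; apply/mnmP => j.
  by rewrite mnmE ffunE.
move/rowP/(_ (enum_rank t)): vA; rewrite !mxE => vA; apply: etrans vA.
rewrite [LHS](reindex (fun j : 'I_#|I| => enum_val j)) /=; last first.
  by apply: onW_bij; apply: enum_val_bij.
by apply: eq_bigr => i _; rewrite !mxE mcoeffZ enum_valK enum_rankK.
Qed.

(** If W is contained in the closure of the image of a polynomial map from the
    affine k-space, whose comorphism is phi, then a chain of irreducible closed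
    subsets of W has at most k members. *)
Lemma chain_length (W : set P) (X : nat -> set P) L d :
  (forall f, phi f = 0 -> vanishes_on W f) -> X 0%N L -> X d `<=` W ->
  (forall i, (i <= d)%N -> zclosed (X i) /\ vanishing_prime (X i)) ->
  (forall i, (i < d)%N -> X i `<=` X i.+1 /\ X i <> X i.+1) -> (d < k)%N.
Proof.
move=> hphi X0L XW cl ch; rewrite ltnNge; apply/negP => kd.
have [e he] := chain_free_mod X0L cl ch.
(* With this M, the number M^(d+1) of members exceeds ((e + 1) M)^k. *)
pose M := (e.+1 ^ k).+1.
have [I [m [cI sm lm]]] := he M.
have [c [i ci] c0] : exists2 c : I -> F, (exists i, c i != 0) &
    \sum_i c i *: phi (m i) = 0.
  apply: (@mpoly_dependent _ _ (e.+1 * M)%N) => [i|].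
    by apply: leq_trans (sm i) _; rewrite mulSn -add1n leq_add2r.
  rewrite cI expnMn; apply: (@leq_trans (M ^ k.+1)%N).
    by rewrite expnS ltn_pmul2r ?expn_gt0.
  by rewrite leq_pexp2l.
move/eqP: ci; apply; apply: lm; apply: vanishes_on_sub XW _; apply: hphi.
by rewrite raddf_sum -[RHS]c0; apply: eq_bigr => j _; rewrite /= linearZ.
Qed.
End Chain.
End Projective.

(** * The locus Z: parametrisation and dimension *)

Lemma sq_coef_morph (S S' : comNzRingType) (h : {rmorphism S -> S'}) p q r j :
  h (sq_coef p q r j) = sq_coef (h p) (h q) (h r) j.
Proof.
have h2 := rmorph_nat h 2; move: j; case; do 6 (case; first by
  move=> ?; rewrite /sq_coef /= ?(rmorphXn, rmorphM) ?h2).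
by [].
Qed.

Lemma pencil_coef_morph (S S' : comNzRingType) (h : {rmorphism S -> S'})
    v0 v1 u0 u1 a b c j :
  h (pencil_coef v0 v1 u0 u1 a b c j) =
  pencil_coef (h v0) (h v1) (h u0) (h u1) (h a) (h b) (h c) j.
Proof.
have h2 := rmorph_nat h 2.
rewrite /pencil_coef !rmorphD !rmorphM !sq_coef_morph !rmorphXn.
by rewrite !rmorphM h2 rmorphD !rmorphM.
Qed.

Lemma det_mx2 (F : fieldType) (A : 'M[F]_2) :
  \det A = A 0 0 * A 1 1 - A 0 1 * A 1 0.
Proof.
rewrite (expand_det_row _ 0) !big_ord_recl big_ord0 /cofactor addr0.
rewrite !det_mx11 !mxE /= expr0 expr1 mul1r mulN1r mulrN.
by do ! [congr (_ - _) | congr (_ * _) | congr (A _ _)]; apply: val_inj.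
Qed.

Lemma row_mx2 (F : fieldType) (v u : 'cV[F]_2) i :
  (row_mx v u i 0 = v i 0) * (row_mx v u i 1 = u i 0).
Proof.
split; first by rewrite -(row_mxEl v u); congr (row_mx v u i _); apply: val_inj.
by rewrite -(row_mxEr v u); congr (row_mx v u i _); apply: val_inj.
Qed.

Lemma unit_row_mx2 (F : fieldType) (v u : 'cV[F]_2) :
  (row_mx v u \in unitmx) = (v 0 0 * u 1 0 - u 0 0 * v 1 0 != 0).
Proof. by rewrite unitmxE unitfE det_mx2 !row_mx2. Qed.

Section Parametrisation.
Local Open Scope classical_set_scope.
Variables (R : realType) (J : abelian_surface R).
Local Notation C := R[i].
Local Notation U := (B2 J).
Local Notation n := (\dim U).
Local Notation crd := (coord (vbasis U)).

Lemma crd_Psi i m : crd i (Psi m) = \sum_(j < 6) m j * crd i (sixprod C)`_j.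
Proof. by rewrite linear_sum; apply: eq_bigr => j _; rewrite linearZ. Qed.

Lemma curve_Psi (m : 'I_6 -> {poly C}) (f : {mpoly C[n]}) t :
  (curve (fun i => \sum_(j < 6) crd i (sixprod C)`_j *: m j) f).[t] =
  peval f (Psi (fun j => (m j).[t])).
Proof.
rewrite curve_horner; apply: meval_eq => i; rewrite crd_Psi horner_sum.
by apply: eq_bigr => j _; rewrite hornerZ mulrC.
Qed.

(** The coordinates of the class with eigenvectors (X_0, 1) and (X_1, 1) and
    coefficients X_2, X_3, X_4. *)
Definition pencil_chart : n.-tuple {mpoly C[5]} :=
  [tuple \sum_(j < 6) crd i (sixprod C)`_j *:
     pencil_coef 'X_0 1 'X_1 1 'X_(2%:R) 'X_(3%:R) 'X_(4%:R) j | i < n].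

Lemma pencil_chartE f (al be a b c : C) :
  (comp_mpoly pencil_chart f).@[fun i => [:: al; be; a; b; c]`_i] =
  peval f (Psi (pencil_coef al 1 be 1 a b c)).
Proof.
rewrite comp_mpoly_meval; apply: meval_eq => i; rewrite tnth_mktuple crd_Psi.
rewrite raddf_sum; apply: eq_bigr => j _.
rewrite /= mevalZ mulrC (pencil_coef_morph (meval _)).
rewrite /= !mevalXU meval1; congr (_ * _).
Qed.

(** The chart misses the eigenvectors with zero second entry; they are limits
    of the eigenvectors (v_0, v_1 + t). *)
Lemma pencil_chart_vanishing f : comp_mpoly pencil_chart f = 0 ->
  forall v0 v1 u0 u1 a b c,
  peval f (Psi (pencil_coef v0 v1 u0 u1 a b c)) = 0.
Proof.
move=> f0 v0 v1 u0 u1 a b c.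
have nz w0 w1 z0 z1 : w1 != 0 -> z1 != 0 ->
    peval f (Psi (pencil_coef w0 w1 z0 z1 a b c)) = 0.
  move=> w1n z1n; rewrite (_ : Psi _ = Psi (pencil_coef (w0 / w1) 1 (z0 / z1) 1
    (a * w1 ^+ 4) (b * z1 ^+ 4) (c * w1 ^+ 2 * z1 ^+ 2))).
    by rewrite -pencil_chartE f0 meval0.
  apply: eq_Psi; rewrite /pencil_coef /sq_coef; case; do 6 (case; first by
    move=> ? /=; field; rewrite ?w1n ?z1n).
  by [].
pose m := pencil_coef v0%:P (v1%:P + 'X) u0%:P (u1%:P + 'X) a%:P b%:P c%:P.
have mE t : Psi (fun j => (m j).[t]) =
      Psi (pencil_coef v0 (v1 + t) u0 (u1 + t) a b c).
  apply: eq_Psi => j; rewrite -[LHS]/(horner_eval t _) pencil_coef_morph.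
  by rewrite /= /horner_eval !hornerE.
pose g := curve (fun i => \sum_(j < 6) crd i (sixprod C)`_j *: m j) f.
have g0 : g = 0.
  apply: (@poly_gen_eq0 _ ((v1%:P + 'X) * (u1%:P + 'X))).
    by rewrite mulf_neq0 // addrC -size_poly_gt0 size_XaddC.
  move=> t; rewrite hornerM !hornerE mulf_eq0 negb_or => /andP[h1 h2].
  by rewrite /g curve_Psi mE nz.
have := curve_Psi m f 0; rewrite mE !addr0 => <-.
by rewrite -/g g0 horner0.
Qed.

Lemma pencil_chart_ideal f : comp_mpoly pencil_chart f = 0 -> vanishes_on (Z J) f.
Proof.
move=> f0; apply: vanishes_on_closure => L [K [v [u [_ _ LB]]]] x /(subvP LB).
by move=> /mem_B2K [a [b [c ->]]]; apply: pencil_chart_vanishing.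
Qed.

(** A chain of irreducible closed subsets of Z has at most 5 members. *)
Lemma local_dim_Z L d : local_dim (Z J) L d -> (d < 5)%N.
Proof.
move=> [[X [X0L XZ irr ch]] _].
apply: (@chain_length _ _ _ 5 (comp_mpoly pencil_chart) (Z J) X L d) => //.
  exact: pencil_chart_ideal.
by move=> i id; have [cl ir] := irr i id; split=> //; apply: zirreducible_vanishing_prime.
Qed.
End Parametrisation.

(** * Linear forms on Sym^2 of Sym^2 *)

Section LinearForm.
Variable F : numFieldType.

Lemma eq_lin3 (p q r p' q' r' : F) : p = p' -> q = q' -> r = r' ->
  lin3 p q r = lin3 p' q' r'.
Proof. by move=> -> -> ->. Qed.

Lemma omega_vecD (v u : 'cV[F]_2) t :
  omega_vec (v + t *: u) = omega_vec v + t *: omega_pair v u + t ^+ 2 *: omega_vec u.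
Proof.
rewrite !omega_vec_lin3 omega_pair_lin3 -[lin3 (v 0 0 ^+ 2) _ _]scale1r lin3_comb.
have vE i : (v + t *: u) i 0 = v i 0 + t * u i 0 by rewrite !mxE.
by apply: eq_lin3; rewrite ?vE; ring.
Qed.

(** When v and u form a basis, v^2, v u and u^2 span Sym^2. *)
Lemma omega_comb (v u : 'cV[F]_2) (p q r : F) : row_mx v u \in unitmx ->
  exists a b c, lin3 p q r =
    a *: omega_vec v + b *: omega_pair v u + c *: omega_vec u.
Proof.
rewrite unit_row_mx2 => D0.
pose D := v 0 0 * u 1 0 - u 0 0 * v 1 0.
exists ((p * u 1 0 ^+ 2 - 2 * q * (u 0 0 * u 1 0) + r * u 0 0 ^+ 2) / D ^+ 2).
exists ((- p * (u 1 0 * v 1 0) + q * (u 1 0 * v 0 0 + u 0 0 * v 1 0)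
   - r * (u 0 0 * v 0 0)) / D ^+ 2).
exists ((p * v 1 0 ^+ 2 - 2 * q * (v 0 0 * v 1 0) + r * v 0 0 ^+ 2) / D ^+ 2).
rewrite !omega_vec_lin3 omega_pair_lin3 lin3_comb /D.
by apply: eq_lin3; field.
Qed.

(** A polynomial of degree 4 that vanishes at the integers k - 2 has zero
    coefficients; the five values -2, ..., 2 suffice.  Here m is the whole
    coefficient of t^2, and the odd coefficients are 2 b and 2 c. *)
Lemma quartic_eq0 (a b m c d : F) :
  (forall k : nat, let t := k%:R - 2 in
    a + 2 * t * b + t ^+ 2 * m + 2 * t ^+ 3 * c + t ^+ 4 * d = 0) ->
  [/\ a = 0, b = 0, m = 0, c = 0 & d = 0].
Proof.
set g := fun t => a + 2 * t * b + t ^+ 2 * m + 2 * t ^+ 3 * c + t ^+ 4 * d.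
move=> h; have g0 k : g (k%:R - 2) = 0 by apply: h.
have gm2 : g (- 2) = 0 by have := g0 0%N; rewrite sub0r.
have gm1 : g (- 1) = 0 by rewrite -(g0 1%N); congr g; ring.
have g00 : g 0 = 0 by have := g0 2%N; rewrite subrr.
have g1 : g 1 = 0 by rewrite -(g0 3%N); congr g; ring.
have g2 : g 2 = 0 by rewrite -(g0 4%N); congr g; ring.
have nz (k : nat) (x : F) : k.+1%:R * x = 0 -> x = 0.
  by move/eqP; rewrite mulf_eq0 pnatr_eq0 => /eqP.
have a0 : a = 0 by rewrite -g00 /g; ring.
have d0 : d = 0.
  apply: (nz 23%N); transitivity (g 2 + g (- 2) - 4 * (g 1 + g (- 1)) + 6 * g 0).
    by rewrite /g; ring.
  by rewrite g2 gm2 g1 gm1 g00; ring.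
have c0 : c = 0.
  apply: (nz 23%N); transitivity (g 2 - g (- 2) - 2 * (g 1 - g (- 1))).
    by rewrite /g; ring.
  by rewrite g2 gm2 g1 gm1; ring.
split=> //.
  apply: (nz 3%N); transitivity (g 1 - g (- 1) - 4 * c); first by rewrite /g; ring.
  by rewrite g1 gm1 c0; ring.
apply: (nz 1%N); transitivity (g 1 + g (- 1) - 2 * (a + d)); first by rewrite /g; ring.
by rewrite g1 gm1 a0 d0; ring.
Qed.

Variable lam : ext F (4 + 4) -> F.
Hypothesis lamD : forall y z, lam (y + z) = lam y + lam z.
Hypothesis lamZ : forall k y, lam (k *: y) = k * lam y.

Lemma linear_form_sq (a b c : ext F (4 + 4)) t :
  wedge b a = wedge a b -> wedge c a = wedge a c -> wedge c b = wedge b c ->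
  lam (sq (a + t *: b + t ^+ 2 *: c)) =
  lam (wedge a a) + 2 * t * lam (wedge a b)
  + t ^+ 2 * (lam (wedge b b) + 2 * lam (wedge a c))
  + 2 * t ^+ 3 * lam (wedge b c) + t ^+ 4 * lam (wedge c c).
Proof.
move=> ba ca cb; rewrite /sq !wedgeDl !wedgeDr !wedgeZl !wedgeZr ba ca cb.
by rewrite !lamD !lamZ; ring.
Qed.

Lemma linear_form_wedge_eq0 (A P B : ext F (4 + 4)) a b c a' b' c' :
  wedge P A = wedge A P -> wedge B A = wedge A B -> wedge B P = wedge P B ->
  lam (wedge A A) = 0 -> lam (wedge A P) = 0 -> lam (wedge A B) = 0 ->
  lam (wedge P P) = 0 -> lam (wedge P B) = 0 -> lam (wedge B B) = 0 ->
  lam (wedge (a *: A + b *: P + c *: B) (a' *: A + b' *: P + c' *: B)) = 0.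
Proof.
move=> PA BA BP; rewrite !wedgeDl !wedgeDr !wedgeZl !wedgeZr PA BA BP.
move=> h1 h2 h3 h4 h5 h6.
by rewrite !lamD !lamZ h1 h2 h3 h4 h5 h6 !mulr0 !addr0.
Qed.

(** A linear form that vanishes on (v + t u)^4 for five values of t, and on
    (2 v u)^2, vanishes on the six products. *)
Lemma linear_form_sixprod_eq0 (v u : 'cV[F]_2) : row_mx v u \in unitmx ->
  (forall k : nat, lam (sq (omega_vec (v + (k%:R - 2) *: u))) = 0) ->
  lam (sq (omega_pair v u)) = 0 ->
  forall j : 'I_6, lam (sixprod F)`_j = 0.
Proof.
move=> vu hv pp; pose A := omega_vec v; pose B := omega_vec u.
pose P := omega_pair v u.
have PA : wedge P A = wedge A P by apply: lin3C.
have BA : wedge B A = wedge A B by apply: lin3C.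
have BP : wedge B P = wedge P B by apply: lin3C.
have [aa ap m pb bb] : [/\ lam (wedge A A) = 0, lam (wedge A P) = 0,
    lam (wedge P P) + 2 * lam (wedge A B) = 0,
    lam (wedge P B) = 0 & lam (wedge B B) = 0].
  by apply: quartic_eq0 => i /=; rewrite -linear_form_sq // -omega_vecD hv.
have ab : lam (wedge A B) = 0.
  by move/eqP: m; rewrite [wedge P P]/(sq P) pp add0r mulf_eq0 pnatr_eq0 => /eqP.
have all0 p q r p' q' r' : lam (wedge (lin3 p q r) (lin3 p' q' r')) = 0.
  have [a [b [c ->]]] := omega_comb p q r vu.
  have [a' [b' [c' ->]]] := omega_comb p' q' r' vu.
  exact: linear_form_wedge_eq0.
have w1E : omega1 F = lin3 1 0 0 by rewrite /lin3 !scale0r scale1r !addr0.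
have w2E : omega2 F = lin3 0 0 1 by rewrite /lin3 !scale0r scale1r !add0r.
have wsE : omega_sigma F = lin3 0 1 0 by rewrite /lin3 !scale0r scale1r addr0 add0r.
rewrite /sixprod w1E w2E wsE.
by case; do 6 (case; first by move=> ? /=; apply: all0).
Qed.
End LinearForm.

(** * Singular points of Z *)

Section CartanBasis.
Variables (F : numFieldType) (v u : 'cV[F]_2).
Hypothesis vu : row_mx v u \in unitmx.

(** Every basis of the plane is an eigenbasis of a Cartan subalgebra. *)
Lemma cartan_of_basis : exists K : {vspace 'M[F]_2},
  cartan K /\ common_eigenbasis K v u.
Proof.
pose P : 'M[F]_2 := row_mx v u.
pose E := P *m delta_mx 0 0 *m invmx P.
have EE : E *m E = E.
  by rewrite /E !mulmxA mulmxKV // -(mulmxA P) mul_delta_mx.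
have colP (i : 'I_2) w : w = col i P -> E *m w = (i == 0)%:R *: w.
  move=> ->; rewrite colE /E !mulmxA mulmxKV // -(mulmxA P) mul_delta_mx_cond.
  rewrite eq_sym; case: eqP => [->|_]; rewrite ?mulr1n ?scale1r //.
  by rewrite mulr0n mulmx0 scale0r.
have Ev : E *m v = v.
  rewrite (colP 0) ?eqxx ?scale1r //.
  by apply/matrixP => i j; rewrite ord1 mxE row_mx2.
have Eu : E *m u = 0.
  rewrite (colP 1) ?scale0r //.
  by apply/matrixP => i j; rewrite ord1 mxE row_mx2.
have Kmem k : k \in <<[:: 1%:M; E]>>%VS <-> exists a b, k = a *: 1%:M + b *: E.
  rewrite !span_cons span_nil addv0; split.
    by case/memv_addP => _ /vlineP[a ->] [_ /vlineP[b ->] ->]; exists a, b.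
  by case=> a [b ->]; apply: memv_add; rewrite memvZ ?memv_line.
exists <<[:: 1%:M; E]>>%VS; split; last first.
  split=> // k /Kmem [a [b ->]]; split.
    by exists (a + b); rewrite mulmxDl -!scalemxAl mul1mx Ev scalerDl.
  by exists a; rewrite mulmxDl -!scalemxAl mul1mx Eu scaler0 addr0.
have conjE a b : invmx P *m (a *: 1%:M + b *: E) *m P =
    a *: 1%:M + b *: delta_mx 0 0.
  rewrite mulmxDr mulmxDl -!scalemxAr -!scalemxAl mulmx1 mulVmx //.
  by rewrite /E !mulmxA mulVmx // mul1mx mulmxKV.
split.
- by apply/Kmem; exists 1, 0; rewrite scale1r scale0r addr0.
- move=> k l /Kmem [a [b ->]] /Kmem [c [d ->]]; apply/Kmem.
  exists (a * c), (a * d + b * c + b * d).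
  rewrite mulmxDl !mulmxDr -!scalemxAl -!scalemxAr !mul1mx !mulmx1 EE !scalerA.
  by rewrite !scalerDl !addrA.
- suff fr : free [tuple 1%:M; E] by exact: (eqnP fr).
  have : forall c : 'I_2 -> F,
      \sum_(i < 2) c i *: [tuple 1%:M; E]`_i = 0 -> forall i, c i = 0.
    move=> c; rewrite !big_ord_recl big_ord0 addr0 /= => c0.
    have : invmx P *m (c ord0 *: 1%:M + c (lift ord0 ord0) *: E) *m P = 0.
      by rewrite c0 mulmx0 mul0mx.
    rewrite conjE => /matrixP m0.
    have c00 : c ord0 = 0.
      by have := m0 1 1; rewrite !mxE /= mulr1 mulr0 addr0.
    have c01 : c (lift ord0 ord0) = 0.
      by have := m0 0 0; rewrite !mxE /= c00 mul0r add0r mulr1.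
    by move=> i; case: (unliftP ord0 i) => [j ->|-> //]; rewrite (ord1 j).
  by move=> h; apply/freeP.
- exists (invmx P); first by rewrite unitmx_inv.
  move=> k /Kmem [a [b ->]]; rewrite invmxK conjE.
  apply/is_diag_mxP => i j ij; rewrite !mxE.
  have -> : (i == j) = false by apply: contraNF ij => /eqP ->.
  rewrite mulr0 add0r.
  have -> : (i == 0) && (j == 0) = false.
    by apply: contraNF ij => /andP[/eqP -> /eqP ->].
  by rewrite mulr0.
Qed.
End CartanBasis.

Section SingularPoints.
Local Open Scope classical_set_scope.
Variables (R : realType) (J : abelian_surface R).
Local Notation C := R[i].
Local Notation U := (B2 J).
Local Notation n := (\dim U).
Local Notation crd := (coord (vbasis U)).

Lemma vanishes_Z_B2K f L (v u : 'cV[C]_2) x : Z J L ->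
  (forall L', Z J L' -> vanishes_at f L') -> row_mx v u \in unitmx ->
  x \in B2K v u -> peval f x = 0.
Proof.
move=> ZL hf vu xB; have [->|x0] := eqVneq x 0.
  by apply: (hf L) => //; rewrite mem0v.
have Lx : (<[x]> <= U)%VS && (\dim <[x]>%VS == 1%N).
  by rewrite dim_vline x0 andbT -memvE (subvP (B2K_sub J v u)).
pose L' : proj U := exist _ <[x]>%VS Lx.
suff ZL' : Z J L' by apply: (hf L' ZL'); rewrite /= memv_line.
have [K [cK eK]] := cartan_of_basis vu.
by move=> Y _; apply; exists K, v, u; split=> //=; rewrite -memvE.
Qed.

(** The differential of f at x, in the direction y. *)
Definition diff (f : {mpoly C[n]}) (x y : ext C (4 + 4)) : C :=
  \sum_(i < n) peval f^`M(i) x * crd i y.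

Lemma diffD f x y z : diff f x (y + z) = diff f x y + diff f x z.
Proof.
by rewrite /diff -big_split; apply: eq_bigr => i _; rewrite linearD mulrDr.
Qed.

Lemma diffZ f x k y : diff f x (k *: y) = k * diff f x y.
Proof.
by rewrite /diff mulr_sumr; apply: eq_bigr => i _; rewrite linearZ mulrCA.
Qed.

Lemma diff_eq0 f x y : (forall t, peval f (x + t *: y) = 0) -> diff f x y = 0.
Proof.
move=> h; pose g i : {poly C} := (crd i x)%:P + crd i y *: 'X.
have g0 : curve g f = 0.
  apply: poly_inf_eq0 => t; rewrite curve_horner -[RHS](h t); apply: meval_eq => i.
  by rewrite !hornerE linearD linearZ mulrC.
have := curve_deriv g f 0; rewrite g0 deriv0 horner0 => ->.
apply: eq_bigr => i _; congr (_ * _); last first.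
  by rewrite derivD derivC add0r derivZ derivX hornerZ hornerC mulr1.
by apply: meval_eq => j; rewrite !hornerE ?mulr0 ?addr0.
Qed.

Lemma diff_B2K f L (v u : 'cV[C]_2) x y : Z J L ->
  (forall L', Z J L' -> vanishes_at f L') -> row_mx v u \in unitmx ->
  x \in B2K v u -> y \in B2K v u -> diff f x y = 0.
Proof.
move=> ZL hf vu xB yB; apply: diff_eq0 => t.
by apply: (vanishes_Z_B2K ZL hf vu); rewrite memvD ?memvZ.
Qed.

(** v^2 + u^2 = (1 + t^2)^-1 (v_t^2 + u_t^2) for v_t = v + t u, u_t = u - t v;
    so the rank one class of v^2 + u^2 lies in B^2_K for all these pairs. *)
Lemma B2K_rotate (v u : 'cV[C]_2) k t : 1 + t ^+ 2 != 0 ->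
  k *: Psi (pencil_coef (v 0 0) (v 1 0) (u 0 0) (u 1 0) 1 1 2^-1) \in
  B2K (v + t *: u) (u - t *: v).
Proof.
move=> t0; apply/mem_B2K.
exists (k / (1 + t ^+ 2) ^+ 2), (k / (1 + t ^+ 2) ^+ 2),
  (k / (1 + t ^+ 2) ^+ 2 / 2).
rewrite PsiZ; apply: eq_Psi; rewrite /pencil_coef /sq_coef !mxE.
case; do 6 (case; first by
  move=> ? /=; field; rewrite ?t0 ?pnatr_eq0).
by [].
Qed.

(** The polynomials vanishing on Z have zero differential, along all the six
    products, on the line of the class of v^2 + u^2. *)
Lemma diff_sixprod f L (v u : 'cV[C]_2) k : Z J L ->
  (forall L', Z J L' -> vanishes_at f L') -> row_mx v u \in unitmx ->
  forall j : 'I_6, diff f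
    (k *: Psi (pencil_coef (v 0 0) (v 1 0) (u 0 0) (u 1 0) 1 1 2^-1)) (sixprod C)`_j = 0.
Proof.
move=> ZL hf vu; set x := k *: _.
have t0 (i : nat) : 1 + (i%:R - 2 : C) ^+ 2 != 0.
  have -> : i%:R - 2 = (i%:R - 2 : R)%:C%C :> C by rewrite rmorphB /= !rmorph_nat.
  rewrite -rmorphXn -(rmorph1 (real_complex R)) -rmorphD /=.
  rewrite -(rmorph0 (real_complex R)).
  rewrite (inj_eq (fmorph_inj _)) gt_eqF // ltr_wpDr ?sqr_ge0 //.
have vt_unit t : 1 + t ^+ 2 != 0 -> row_mx (v + t *: u) (u - t *: v) \in unitmx.
  move=> h; move: vu; rewrite !unit_row_mx2 !mxE => D0.
  rewrite (_ : _ - _ = (1 + t ^+ 2) * (v 0 0 * u 1 0 - u 0 0 * v 1 0)) ?mulf_neq0 //.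
  by ring.
have vanish t y : 1 + t ^+ 2 != 0 -> y \in B2K (v + t *: u) (u - t *: v) ->
    diff f x y = 0.
  move=> h; apply: (diff_B2K ZL hf (vt_unit t h)); exact: B2K_rotate.
apply: (linear_form_sixprod_eq0 (diffD f x) (diffZ f x) vu) => [i|].
  apply: (vanish (i%:R - 2) _ (t0 i)).
  exact: sq_omega_vec_B2K.
apply: (vanish 0); first by rewrite expr0n addr0 oner_neq0.
by rewrite !scale0r addr0 subr0; apply: sq_omega_pair_B2K.
Qed.

(** At the class of v^2 + u^2, the tangent space of the cone over Z has dimension
    at least 6, but Z has dimension at most 4. *)
Lemma rank_one_singular L (v u : 'cV[C]_2) : Z J L ->
  row_mx v u \in unitmx ->
  \val L = <[Psi (pencil_coef (v 0 0) (v 1 0) (u 0 0) (u 1 0) 1 1 2^-1)%R]>%VS ->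
  Sing (Z J) L.
Proof.
move=> ZL vu Lx; split=> // -[d [T [ld tT dT]]].
have d5 := local_dim_Z ld.
have : (<<sixprod C>> <= T)%VS.
  apply/span_subvP => _ /(nthP 0)[j j6 <-]; apply/tT; split.
    exact: (sixprod_B2 J (Ordinal j6)).
  move=> f hf fZ x; rewrite Lx => /vlineP[k ->].
  exact: (diff_sixprod k ZL fZ vu (Ordinal j6)).
move/dimvS; rewrite (eqnP (sixprod_free C)) size_tuple dT => h.
by move: (leq_trans h d5).
Qed.
End SingularPoints.

Section Pencil.
Variable F : numFieldType.

(** Two presentations of one class, with eigenvectors (a, 1), (b, 1) and (c, 1),
    (d, 1).  The linear combinations [l1], [l2], [l3] of the coordinates are the
    entries of the contraction of Q' with the linear form z^2 |-> [z,v] [z,w] on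
    Sym^2, where Q' is the class minus its invariant part; they vanish on the
    first presentation since the form kills v^2 and w^2. *)
Lemma pencil_eqs (a b c d al be q al' be' q' : F) :
  pencil_coef a 1 b 1 al be q =1 pencil_coef c 1 d 1 al' be' q' -> c != d ->
  al' * ((c - a) * (c - b)) + 2 * q' * ((d - a) * (d - b)) = 0 /\
  be' * ((d - a) * (d - b)) + 2 * q' * ((c - a) * (c - b)) = 0.
Proof.
move=> mm cd.
have m0 := mm 0; have m1 := mm 1; have m2 := mm 2%:R; have m3 := mm 3%:R.
have m4 := mm 4%:R; have m5 := mm 5%:R.
pose E := al' * ((c - a) * (c - b)) + 2 * q' * ((d - a) * (d - b)).
pose G := be' * ((d - a) * (d - b)) + 2 * q' * ((c - a) * (c - b)).
pose l1 (m : 'I_6 -> F) :=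
  2 * m 0 + (4 * m 5%:R - m 1) * (a * b) - m 3%:R * (a + b).
pose l2 (m : 'I_6 -> F) :=
  (4 * m 5%:R - m 1) + 2 * m 2%:R * (a * b) - m 4%:R * (a + b).
pose l3 (m : 'I_6 -> F) := m 3%:R + m 4%:R * (a * b) - m 1 * (a + b).
have e1 : E * c ^+ 2 + G * d ^+ 2 = 0.
  transitivity (2^-1 * l1 (pencil_coef c 1 d 1 al' be' q')).
    by rewrite /l1 /pencil_coef /sq_coef /= /E /G; field.
  by rewrite /l1 -m0 -m1 -m3 -m5 /pencil_coef /sq_coef /=; ring.
have e2 : E + G = 0.
  transitivity (2^-1 * l2 (pencil_coef c 1 d 1 al' be' q')).
    by rewrite /l2 /pencil_coef /sq_coef /= /E /G; field.
  by rewrite /l2 -m1 -m2 -m4 -m5 /pencil_coef /sq_coef /=; ring.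
have e3 : E * c + G * d = 0.
  transitivity (2^-1 * l3 (pencil_coef c 1 d 1 al' be' q')).
    by rewrite /l3 /pencil_coef /sq_coef /= /E /G; field.
  by rewrite /l3 -m1 -m3 -m4 /pencil_coef /sq_coef /=; ring.
have EG : E = - G by apply/eqP; rewrite -addr_eq0 e2.
have G0 : G = 0.
  move: e3; rewrite EG mulNr addrC -mulrBr => /eqP.
  by rewrite mulf_eq0 subr_eq0 (eq_sym d) (negPf cd) orbF => /eqP.
by split=> //; rewrite -/E EG G0 oppr0.
Qed.

Lemma vline_Psi (k : F) (m m' : 'I_6 -> F) : k != 0 ->
  m =1 (fun j => k * m' j) -> <[Psi m]>%VS = <[Psi m']>%VS.
Proof.
move=> k0 /eq_Psi; rewrite -PsiZ => ->; move: (Psi m') => x.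
apply/eqP; rewrite eqEsubv -!memvE memvZ ?memv_line //=.
by apply/vlineP; exists k^-1; rewrite scalerA mulVf ?scale1r.
Qed.

(** Rescaling w turns a v^4 + b w^4 + q (2 v w)^2, for ab = 4 q^2, into a
    multiple of v^4 + w^4 + (2 v w)^2 / 2. *)
Lemma pencil_coef_scale (v0 v1 w0 w1 a b q s : F) : a != 0 ->
  s ^+ 2 = 2 * q / a -> a * b = 4 * q ^+ 2 ->
  pencil_coef v0 v1 w0 w1 a b q =1
  (fun j => a * pencil_coef v0 v1 (s * w0) (s * w1) 1 1 2^-1 j).
Proof.
move=> a0 s2 ab j.
have -> : pencil_coef v0 v1 (s * w0) (s * w1) 1 1 2^-1 j =
    pencil_coef v0 v1 w0 w1 1 ((s ^+ 2) ^+ 2) (2^-1 * s ^+ 2) j.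
  move: j; rewrite /pencil_coef /sq_coef.
  case; do 6 (case; first by move=> ? /=; ring).
  by [].
have -> : b = a * (2 * q / a) ^+ 2 by apply: (mulfI a0); rewrite ab; field.
rewrite s2; move: j; rewrite /pencil_coef /sq_coef; case; do 6 (case; first by
  move=> ? /=; field).
by [].
Qed.
End Pencil.

Section Singular.
Variables (R : realType) (J : abelian_surface R).
Local Notation C := R[i].

(** The relation ab = 4 q^2 says that a v^4 + b w^4 + q (2 v w)^2 corresponds to
    the square of an element of Sym^2. *)
Lemma singular_point L (v w : 'cV[C]_2) a b q : Z J L ->
  row_mx v w \in unitmx -> q != 0 -> a * b = 4 * q ^+ 2 ->
  \val L = <[Psi (pencil_coef (v 0 0) (v 1 0) (w 0 0) (w 1 0) a b q)%R]>%VS ->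
  Sing (Z J) L.
Proof.
move=> ZL vw q0 ab Lx.
have a0 : a != 0.
  apply: contraNneq q0 => a0; move/eqP: ab; rewrite a0 mul0r eq_sym mulf_eq0.
  by rewrite expf_eq0 pnatr_eq0.
pose s := sqrtC (2 * q / a).
have s2 : s ^+ 2 = 2 * q / a by rewrite sqrtCK.
have s0 : s != 0.
  have : s ^+ 2 != 0 by rewrite s2 !mulf_neq0 ?invr_neq0 ?pnatr_eq0.
  by rewrite expf_eq0.
have vsw : row_mx v (s *: w) \in unitmx.
  move: vw; rewrite !unit_row_mx2 !mxE => D0.
  by rewrite (mulrCA _ s) -(mulrA s) -mulrBr mulf_neq0.
apply: (rank_one_singular ZL vsw).
by rewrite Lx (vline_Psi a0 (pencil_coef_scale _ _ _ _ a0 s2 ab)) !mxE.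
Qed.
End Singular.

(** * At most one field at a nonsingular point *)

Lemma eq_mx2 (T : Type) (A B : 'M[T]_2) : A 0 0 = B 0 0 -> A 0 1 = B 0 1 ->
  A 1 0 = B 1 0 -> A 1 1 = B 1 1 -> A = B.
Proof.
have h (i : 'I_2) : i = 0 \/ i = 1.
  by case: i => [[|[|//]] hi]; [left|right]; apply: val_inj.
by move=> *; apply/matrixP => i j; case: (h i) (h j) => [] -> [] ->.
Qed.

Section FieldOfMultiplications.
Variable R : realType.
Local Notation C := R[i].
Local Notation rC := (map_mx (ratr : rat -> C)).
Implicit Types (K : {vspace 'M[rat]_2}) (a : C).

Lemma conj_ratr (x : rat) : ((ratr x : C)^* = ratr x)%R.
Proof. exact: fmorph_rat. Qed.

Lemma mem_tensorC K k : k \in K -> rC k \in tensorC R K.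
Proof.
move=> kK; rewrite (coord_vbasis kK) raddf_sum; apply: memv_suml => i _ /=.
rewrite map_mxZ; apply/memvZ/memv_span/mapP; exists (vbasis K)`_i => //.
by rewrite mem_nth ?size_tuple.
Qed.

Lemma tensorC_eigen K (v : 'cV[C]_2) :
  {in K, forall k, exists x, rC k *m v = x *: v} ->
  {in tensorC R K, forall m, exists x, m *m v = x *: v}.
Proof.
move=> hK m mT; pose X := map_tuple rC (vbasis K).
have {}mT : m \in <<X>>%VS by [].
rewrite (coord_span mT) mulmx_suml; elim/big_ind: _ => [|m1 m2 [x ->] [y ->]|i _].
- by exists 0; rewrite scale0r.
- by exists (x + y); rewrite scalerDl.
have : (vbasis K)`_i \in K by apply/vbasis_mem/mem_nth; rewrite size_tuple.
case/hK => x hx; exists (coord X i m * x).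
by rewrite -scalemxAl -scalerA -hx (nth_map 0) ?size_tuple.
Qed.

(** The equation satisfied by the rational matrices having (a, 1) as an
    eigenvector. *)
Definition eigen_at a (k : 'M[rat]_2) :=
  ratr (k 1 0) * a ^+ 2 + ratr (k 1 1 - k 0 0) * a - ratr (k 0 1) = 0.

Lemma mulmx_vec1 a (k : 'M[rat]_2) :
  (rC k *m vec1 a) 0 0 = ratr (k 0 0) * a + ratr (k 0 1) /\
  (rC k *m vec1 a) 1 0 = ratr (k 1 0) * a + ratr (k 1 1).
Proof.
have o1 : lift ord0 ord0 = 1 :> 'I_2 by apply: val_inj.
by split; rewrite mxE !big_ord_recl big_ord0 !mxE /= o1 mulr1 addr0.
Qed.

Lemma eigen_atP a (k : 'M[rat]_2) lam : rC k *m vec1 a = lam *: vec1 a ->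
  eigen_at a k /\ lam = ratr (k 1 0) * a + ratr (k 1 1).
Proof.
move=> /matrixP h; have [e0 e1] := mulmx_vec1 a k.
have := h 0 0; have := h 1 0; rewrite e0 e1 !mxE /=.
rewrite mulr1 => <- h0; split=> //; rewrite /eigen_at rmorphB.
by move/eqP: h0; rewrite -subr_eq0 => /eqP h0; rewrite -[RHS]oppr0 -h0; ring.
Qed.

Lemma nonreal_linear a (y z : rat) : a^* != a ->
  ratr y * a = ratr z -> y = 0 /\ z = 0.
Proof.
move=> na h; have y0 : y = 0.
  apply: contraNeq na => y0; apply/eqP.
  have ry0 : (ratr y : C) != 0 by rewrite fmorph_eq0.
  have -> : a = ratr z / ratr y by rewrite -h mulrC mulKf.
  by rewrite rmorphM fmorphV /= !conj_ratr.
split=> //; have /eqP : ratr z = 0 :> C by rewrite -h y0 rmorph0 mul0r.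
by rewrite fmorph_eq0 => /eqP.
Qed.

Lemma eigen_at_scalar a (k : 'M[rat]_2) : a^* != a -> eigen_at a k ->
  k 1 0 = 0 -> k = (k 0 0)%:M.
Proof.
rewrite /eigen_at => na + k0; rewrite k0 rmorph0 mul0r add0r => /eqP.
rewrite subr_eq0 => /eqP /(nonreal_linear na) [/eqP]; rewrite subr_eq0 => /eqP k1 k2.
by apply: eq_mx2; rewrite !mxE ?mulr1n ?mulr0n.
Qed.

Lemma quadratic_generator K : imaginary_quadratic K -> exists2 k, k \in K &
  forall x, k != x%:M.
Proof.
move=> [_ _ _ _ [k [d [kK d0 kk]]]]; exists k => // x.
apply: contraTneq d0 => kx; move: kk; rewrite kx -scalar_mxM => /matrixP/(_ 0 0).
rewrite !mxE !eqxx !mulr1n => h.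
by rewrite -leNgt -oppr_ge0 -h -expr2 sqr_ge0.
Qed.

(** The line of a non-real eigenvector (a, 1) determines the field. *)
Lemma quadratic_field_sub K K' a : a^* != a ->
  imaginary_quadratic K -> imaginary_quadratic K' ->
  {in K, forall k, eigen_at a k} -> {in K', forall k, eigen_at a k} ->
  (K' <= K)%VS.
Proof.
move=> na qK qK' eK eK'; have [k kK kn] := quadratic_generator qK.
have k10 : k 1 0 != 0.
  by apply: contraNneq (kn (k 0 0)) => k0; apply/eqP/eigen_at_scalar/k0/eK.
apply/subvP => k' k'K; pose x := k' 1 0 / k 1 0.
have sx : eigen_at a (k' - x *: k).
  have := eK _ kK; have := eK' _ k'K; rewrite /eigen_at !mxE => h' h.
  transitivity ((0 : C) - ratr x * 0); last by rewrite mulr0 subr0.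
  by rewrite -{1}h' -h !(rmorphB, rmorphM); ring.
have -> : k' = x *: k + (k' - x *: k) by rewrite addrC subrK.
rewrite (eigen_at_scalar na sx) ?mxE ?divfK ?subrr //.
by rewrite memvD ?memvZ // -scalemx1 memvZ //; case: qK.
Qed.

Lemma quadratic_field_eq K K' a : a^* != a ->
  imaginary_quadratic K -> imaginary_quadratic K' ->
  {in K, forall k, eigen_at a k} -> {in K', forall k, eigen_at a k} -> K = K'.
Proof.
move=> na qK qK' eK eK'; apply/eqP; rewrite eqEsubv.
by rewrite !(quadratic_field_sub na).
Qed.
End FieldOfMultiplications.

Section Uniqueness.
Variables (R : realType) (J : abelian_surface R).
Local Notation C := R[i].
Implicit Types (K : {vspace 'M[rat]_2}) (a : C).

Lemma vec1E a : (vec1 a 0 0 = a) * (vec1 a 1 0 = 1).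
Proof. by rewrite !mxE. Qed.

Lemma scalar_K_in_C K (v : 'cV[C]_2) (x : rat) : 1%:M \in K ->
  K_in_C K v (ratr x).
Proof.
move=> K1; exists (x *: 1%:M); first by rewrite memvZ.
by rewrite map_mxZ map_mx1 -scalemxAl mul1mx.
Qed.

Lemma is_WK_mem K (v w : 'cV[C]_2) W c : 1%:M \in K -> is_WK J K v w W ->
  c \in W -> exists al be,
    complexify R c = al *: sq (omega_vec v) + be *: sq (omega_vec w).
Proof.
move=> K1 [_ hW] cW; have [+ _] := hW (complexify R c).
case=> [|al [be [_ _ ->]]]; last by exists al, be.
exists (fun i => ratr (coord (vbasis W) i c)); first by move=> i; apply: scalar_K_in_C.
rewrite {1}(coord_vbasis cW) complexify_sum; apply: eq_bigr => i _.
exact: complexifyZ.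
Qed.

(** A class that deforms in the family of K lies in B^2_K. *)
Lemma deforms_point K c : imaginary_quadratic K -> deforms J K c ->
  exists a al be q, [/\ a^* != a,
    {in K, forall k, eigen_at a k} /\ {in K, forall k, eigen_at a^* k} &
    complexify R c = Psi (pencil_coef a 1 a^* 1 al be q)].
Proof.
move=> qK [a [W [q [w [_ [vw eig] hW wW ->]]]]].
have [K1 _ _ _ _] := qK.
have [al [be ->]] := is_WK_mem K1 hW wW.
exists a, al, be, (ratr q); split.
- move: vw; rewrite unit_row_mx2 !vec1E !mulr1.
  by apply: contraNneq => ->; rewrite subrr.
- by split=> k /mem_tensorC /eig [[l hl] [m hm]];
    [have [] := eigen_atP hl|have [] := eigen_atP hm].
- by rewrite addrC pencil_coef_Psi !vec1E.
Qed.

Lemma deforms_unique c L : c <> 0 -> \val L = <[complexify R c]>%VS ->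
  Z J L -> ~ Sing (Z J) L -> forall K K',
  imaginary_quadratic K -> imaginary_quadratic K' ->
  deforms J K c -> deforms J K' c -> K = K'.
Proof.
move=> c0 Lc ZL nS K K' qK qK' dK dK'.
have [a [al [be [q [na [ea eac] ca]]]]] := deforms_point qK dK.
have [b [al' [be' [q' [nb [eb ebc] cb]]]]] := deforms_point qK' dK'.
have [ba|nba] := eqVneq b a.
  by rewrite ba in eb; apply: (quadratic_field_eq na).
have [ba|nbac] := eqVneq b a^*.
  by rewrite ba conjCK in ebc; apply: (quadratic_field_eq na).
have nbca : b^* != a by apply: contraNneq nbac => <-; rewrite conjCK.
have nbcac : b^* != a^* by apply: contraNneq nba => /(can_inj (@conjCK _)) ->.
have mm : pencil_coef a 1 a^* 1 al be q =1 pencil_coef b 1 b^* 1 al' be' q'.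
  by apply: Psi_inj; rewrite -ca -cb.
have nbb : b != b^* by rewrite eq_sym.
have [h1 h2] := pencil_eqs mm nbb.
set X := (b - a) * (b - a^*) in h1 h2; set Y := (b^* - a) * (b^* - a^*) in h1 h2.
have X0 : X != 0 by rewrite mulf_neq0 // subr_eq0.
have Y0 : Y != 0 by rewrite mulf_neq0 // subr_eq0.
have vw : row_mx (vec1 b) (vec1 b^*) \in unitmx.
  by rewrite unit_row_mx2 !vec1E !mulr1 subr_eq0 eq_sym.
have q0 : q' != 0.
  apply/eqP => q0; apply: c0; apply: (@complexify_inj R); rewrite complexify0 cb.
  move: h1 h2; rewrite q0 !mulr0 !mul0r !addr0 => h1 h2.
  have -> : al' = 0 by apply: (mulIf X0); rewrite h1 mul0r.
  have -> : be' = 0 by apply: (mulIf Y0); rewrite h2 mul0r.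
  have := PsiZ 0 (pencil_coef b 1 b^* 1 0 0 0); rewrite scale0r => ->.
  by apply: eq_Psi => j; rewrite /pencil_coef !mul0r !addr0.
case: nS; apply: (singular_point ZL vw q0 (a := al') (b := be')).
  apply: (mulIf (mulf_neq0 X0 Y0)).
  have {}h1 : al' * X = - (2 * q' * Y) by apply/eqP; rewrite -addr_eq0 h1.
  have {}h2 : be' * Y = - (2 * q' * X) by apply/eqP; rewrite -addr_eq0 h2.
  by rewrite mulrACA h1 h2; ring.
by rewrite Lc cb !vec1E.
Qed.
End Uniqueness.

(** * Pairwise non-isomorphic imaginary quadratic fields *)

Section ImaginaryQuadratic.
Variable d : nat.
Hypothesis d0 : (0 < d)%N.
Implicit Types (x y : rat).

(** A rational matrix of square -d, with eigenvectors (+- sqrt(-d), 1). *)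
Definition sqrt_mx : 'M[rat]_2 :=
  \matrix_(i, j) (if i == 0 then (if j == 0 then 0 else - d%:R)
                  else (if j == 0 then 1 else 0)).

(** The element x + y sqrt(-d). *)
Definition quad_elt (x y : rat) : 'M[rat]_2 := x *: 1%:M + y *: sqrt_mx.

(** The field Q(sqrt(-d)), as a subalgebra of the rational matrices. *)
Definition quad_field : {vspace 'M[rat]_2} := <<[:: 1%:M; sqrt_mx]>>%VS.

Lemma mem_quad_field k : k \in quad_field <-> exists x y, k = quad_elt x y.
Proof.
rewrite /quad_field !span_cons span_nil addv0; split.
  by case/memv_addP => _ /vlineP[a ->] [_ /vlineP[b ->] ->]; exists a, b.
by case=> a [b ->]; apply: memv_add; rewrite memvZ ?memv_line.
Qed.

Lemma sqrt_mx_sqr : sqrt_mx *m sqrt_mx = (- d%:R)%:M.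
Proof.
by apply: eq_mx2; rewrite !mxE !big_ord_recl big_ord0 !mxE /=
  ?mulr0 ?mul0r ?mulr1 ?mul1r ?addr0 ?add0r.
Qed.

Lemma quad_elt_mul x y x' y' : quad_elt x y *m quad_elt x' y' =
  quad_elt (x * x' - d%:R * (y * y')) (x * y' + y * x').
Proof.
by apply: eq_mx2; rewrite !mxE !big_ord_recl !big_ord0 !mxE /=; ring.
Qed.

Lemma quad_elt_inj x y x' y' : quad_elt x y = quad_elt x' y' -> x = x' /\ y = y'.
Proof.
move=> /matrixP h; have := h 0 0; have := h 1 0; rewrite !mxE /=.
by rewrite !mulr0 !add0r !mulr1 !addr0.
Qed.

Lemma quad_elt_scalar x : quad_elt x 0 = x%:M.
Proof. by rewrite /quad_elt scale0r addr0 scalemx1. Qed.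

Lemma quad_field_imaginary : imaginary_quadratic quad_field.
Proof.
have d0' : 0 < d%:R :> rat by rewrite ltr0n.
split.
- by apply/mem_quad_field; exists 1, 0; rewrite quad_elt_scalar.
- move=> k l /mem_quad_field [x [y ->]] /mem_quad_field [x' [y' ->]].
  rewrite !quad_elt_mul; split; last by congr quad_elt; ring.
  by apply/mem_quad_field; do 2 eexists.
- move=> k /mem_quad_field [x [y ->]] k0.
  have N0 : x ^+ 2 + d%:R * y ^+ 2 != 0.
    apply: contraNneq k0 => /eqP.
    have y2 : 0 <= d%:R * y ^+ 2 by rewrite mulr_ge0 ?ler0n ?sqr_ge0.
    rewrite (paddr_eq0 (sqr_ge0 x) y2).
    rewrite sqrf_eq0 mulf_eq0 sqrf_eq0 pnatr_eq0 (gtn_eqF d0) /=.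
    move=> /andP[/eqP -> /eqP ->].
    by rewrite quad_elt_scalar raddf0.
  pose N := x ^+ 2 + d%:R * y ^+ 2.
  have inv : quad_elt x y *m quad_elt (x / N) (- y / N) = 1%:M.
    by rewrite quad_elt_mul -quad_elt_scalar; congr quad_elt; rewrite /N; field.
  have [ku _] := mulmx1_unit inv; split=> //.
  apply/mem_quad_field; exists (x / N), (- y / N).
  by rewrite -[RHS]mul1mx -(mulVmx ku) -mulmxA inv mulmx1.
- suff fr : free [tuple 1%:M; sqrt_mx] by exact: (eqnP fr).
  apply/freeP => c; rewrite !big_ord_recl big_ord0 addr0 /= => c0.
  have [c00 c01] : c ord0 = 0 /\ c (lift ord0 ord0) = 0.
    by apply: quad_elt_inj; rewrite /quad_elt c0 !scale0r addr0.
  by move=> i; case: (unliftP ord0 i) => [j ->|-> //]; rewrite (ord1 j).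
- exists sqrt_mx, d%:R; split=> //; last exact: sqrt_mx_sqr.
  by apply/mem_quad_field; exists 0, 1; rewrite /quad_elt scale0r add0r scale1r.
Qed.
End ImaginaryQuadratic.

Section NonIsomorphic.

Lemma no_square_ratio (p q : nat) (s : rat) : prime p -> prime q -> p != q ->
  s ^+ 2 * p%:R <> q%:R.
Proof.
move=> pp pq npq h.
have den0 : (denq s)%:~R != 0 :> rat by rewrite intr_eq0 denq_neq0.
have e : numq s ^+ 2 * p%:Z = q%:Z * denq s ^+ 2.
  apply/eqP; rewrite -(eqr_int rat) [X in X == _]intrM [X in _ == X]intrM.
  rewrite !rmorphXn /=; apply/eqP.
  rewrite -[q%:~R]/(q%:R) -h -{2}(divq_num_den s) expr_div_n.
  by rewrite -[p%:~R]/(p%:R); field.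
have en : (`|numq s| ^ 2 * p = q * `|denq s| ^ 2)%N.
  by move/(congr1 absz): e; rewrite [X in X = _]abszM [X in _ = X]abszM !abszX.
have den1 : (0 < `|denq s|)%N by rewrite absz_gt0 denq_neq0.
have num1 : (0 < `|numq s|)%N.
  case: posnP en => // ->; rewrite exp0n // mul0n => /esym/eqP.
  by rewrite muln_eq0 expn_eq0 andbT !eqn0Ngt den1 prime_gt0.
move/(congr1 (logn p)): en.
rewrite [X in X = _]lognM ?expn_gt0 ?num1 ?prime_gt0 //.
rewrite [X in _ = X]lognM ?expn_gt0 ?den1 ?prime_gt0 // !lognX.
rewrite (logn_prime p pp) (logn_prime p pq) eqxx (negPf npq); lia.
Qed.

Lemma quad_field_not_iso (p q : nat) : prime p -> prime q -> p != q ->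
  ~ field_isomorphic (quad_field p) (quad_field q).
Proof.
move=> pp pq npq [f [finj fim f1 fD fM]].
have [K1 Kmul _ _ _] := quad_field_imaginary (prime_gt0 pp).
have K0 : 0 \in quad_field p by rewrite mem0v.
have f0 : f 0 = 0 by apply: (@addrI _ (f 0)); rewrite -fD // !addr0.
have fn (n : nat) : f n%:R%:M = n%:R%:M.
  elim: n => [|n IH]; first by rewrite !raddf0.
  have Kn : n%:R%:M \in quad_field p by rewrite -scalemx1 memvZ.
  by rewrite -natr1 !raddfD /= fD // IH f1.
have Kr : sqrt_mx p \in quad_field p.
  by apply/mem_quad_field; exists 0, 1; rewrite /quad_elt scale0r add0r scale1r.
have fr : f (sqrt_mx p) *m f (sqrt_mx p) = (- p%:R)%:M.
  have Krr : sqrt_mx p *m sqrt_mx p \in quad_field p by have [] := Kmul _ _ Kr Kr.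
  have := fM _ _ Kr Kr; rewrite -!/(_ *m _) => <-.
  have Kp : p%:R%:M \in quad_field p by rewrite -scalemx1 memvZ.
  apply: (@addIr _ (f p%:R%:M)); rewrite -fD // sqrt_mx_sqr -raddfD addNr raddf0 f0.
  by rewrite fn -raddfD addNr raddf0.
have : f (sqrt_mx p) \in quad_field q by apply/fim; exists (sqrt_mx p).
move/mem_quad_field => [x [y e]]; move: fr; rewrite e quad_elt_mul -(quad_elt_scalar q).
move/quad_elt_inj => [exy]; rewrite mulrC -mulr2n => /eqP.
rewrite mulrn_eq0 /= mulf_eq0 => /orP[|] /eqP z0; last first.
  apply: (@no_square_ratio q p y) => //; first by rewrite eq_sym.
  by apply: oppr_inj; rewrite -exy z0; ring.
have : 0 <= - p%:R :> rat by rewrite -exy z0 !mulr0 subr0 -expr2 sqr_ge0.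
by rewrite oppr_ge0 lern0 => /eqP p0; rewrite p0 in pp.
Qed.

(** An increasing sequence of primes. *)
Fixpoint prime_seq (n : nat) : nat :=
  if n is m.+1 then s2val (prime_above (prime_seq m)) else 2.

Lemma prime_seq_prime n : prime (prime_seq n).
Proof. by case: n => //= n; case: (prime_above _). Qed.

Lemma prime_seq_inj : injective prime_seq.
Proof.
have lt n : (prime_seq n < prime_seq n.+1)%N by rewrite /=; case: (prime_above _).
by apply: incn_inj; apply: leq_mono; apply: homo_ltn => //; apply: ltn_trans.
Qed.
End NonIsomorphic.

(** * A class that deforms in infinitely many families *)

Definition special_coef (j : 'I_6) : rat := [:: 0; 4; 0; 0; 0; 1]`_j.

(** The class omega_sigma^2 + 4 omega_1 omega_2. *)
Definition special_class : ext rat (4 + 4) := Psi special_coef.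

Section SpecialClass.
Variables (R : realType) (J : abelian_surface R) (d : nat).
Hypothesis d0 : (0 < d)%N.
Local Notation C := R[i].
Local Notation K := (quad_field d).
Local Notation rC := (map_mx (ratr : rat -> C)).

(** The square root of -d by which K acts on the first eigenvector. *)
Definition sqrt_neg : C := 'i * sqrtC d%:R.
Local Notation a := sqrt_neg.

Let a2 : a ^+ 2 = - d%:R.
Proof. by rewrite exprMn sqrCi sqrtCK mulN1r. Qed.

Let dC : (d%:R : C) != 0.
Proof. by rewrite pnatr_eq0 -lt0n. Qed.

Let a0 : a != 0.
Proof. by apply: contraNneq dC => a0; rewrite -oppr_eq0 -a2 a0 expr0n. Qed.

Let ca : a^* = - a.
Proof.
rewrite rmorphM /= conjCi mulNr; congr (- (_ * _)); apply: conj_Creal.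
by rewrite ger0_real // sqrtC_ge0 ler0n.
Qed.

Let rC_quad_elt x y :
  rC (quad_elt d x y) = ratr x *: 1%:M + ratr y *: rC (sqrt_mx d).
Proof. by rewrite map_mxD !map_mxZ map_mx1. Qed.

Let sqrt_mx_eigen (b : C) : b ^+ 2 = - d%:R ->
  rC (sqrt_mx d) *m vec1 b = b *: vec1 b.
Proof.
move=> b2; apply/matrixP => i j; rewrite (ord1 j) {j}.
have [e0 e1] := mulmx_vec1 b (sqrt_mx d).
have [->|->] : i = 0 \/ i = 1.
  by case: i => [[|[|//]] hi]; [left|right]; apply: val_inj.
  rewrite e0 !mxE /= -expr2 b2 rmorph0 rmorphN /= ratr_nat; ring.
by rewrite e1 !mxE /= rmorph1 rmorph0; ring.
Qed.

Let quad_elt_eigen x y b : b ^+ 2 = - d%:R ->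
  rC (quad_elt d x y) *m vec1 b = (ratr x + ratr y * b) *: vec1 b.
Proof.
move=> b2; rewrite rC_quad_elt mulmxDl -!scalemxAl mul1mx sqrt_mx_eigen //.
by rewrite scalerA -scalerDl.
Qed.

(** Membership in the subfield Q(sqrt(-d)) of C. *)
Definition in_field (z : C) := exists x y : rat, z = ratr x + ratr y * a.

Lemma K_in_C_quad z : K_in_C K (vec1 a) z <-> in_field z.
Proof.
split=> [[k /mem_quad_field [x [y ->]]]|[x [y ->]]]; last first.
  by exists (quad_elt d x y); [apply/mem_quad_field; exists x, y|rewrite quad_elt_eigen].
rewrite quad_elt_eigen // => /matrixP /(_ 1 0); rewrite !mxE /= !mulr1 => <-.
by exists x, y.
Qed.

Lemma in_field_rat x : in_field (ratr x).
Proof. by exists x, 0; rewrite rmorph0 mul0r addr0. Qed.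

Lemma in_fieldD y z : in_field y -> in_field z -> in_field (y + z).
Proof.
move=> [x [t ->]] [x' [t' ->]]; exists (x + x'), (t + t').
by rewrite !rmorphD /=; ring.
Qed.

Lemma in_fieldM y z : in_field y -> in_field z -> in_field (y * z).
Proof.
move=> [x [t ->]] [x' [t' ->]].
exists (x * x' - d%:R * (t * t')), (x * t' + t * x').
rewrite !(rmorphB, rmorphD) !rmorphM /= ratr_nat.
have -> : ratr x * ratr x' - d%:R * (ratr t * ratr t') =
  ratr x * ratr x' + (a ^+ 2) * (ratr t * ratr t') :> C by rewrite a2 mulNr.
by ring.
Qed.

Lemma in_field_root : in_field a.
Proof. by exists 0, 1; rewrite rmorph0 rmorph1 mul1r add0r. Qed.

Lemma in_field_sum (I : finType) (z : I -> C) : (forall i, in_field (z i)) ->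
  in_field (\sum_i z i).
Proof.
move=> h; elim/big_ind: _ => // [|y t]; last exact: in_fieldD.
by exists 0, 0; rewrite rmorph0 mul0r addr0.
Qed.

(** The coordinates of (omega_2 - d omega_1)^2 - d omega_sigma^2 and of
    omega_sigma (omega_2 - d omega_1).  Since omega_+- = omega_2 - d omega_1 +-
    sqrt(-d) omega_sigma, these span W_K over Q. *)
Definition y1_coef (S : nzRingType) (j : 'I_6) : S :=
  [:: d%:R ^+ 2; - (2 * d%:R); 1; 0; 0; - d%:R]`_j.
Definition y2_coef (S : nzRingType) (j : 'I_6) : S :=
  [:: 0; 0; 0; - d%:R; 1; 0]`_j.

Definition WK : {vspace ext rat (4 + 4)} :=
  <<[:: Psi (@y1_coef rat); Psi (@y2_coef rat)]>>%VS.

Lemma mem_WK c : c \in WK <->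
  exists x y, c = x *: Psi (@y1_coef rat) + y *: Psi (@y2_coef rat).
Proof.
rewrite /WK !span_cons span_nil addv0; split.
  by case/memv_addP => _ /vlineP[x ->] [_ /vlineP[y ->] ->]; exists x, y.
by case=> x [y ->]; apply: memv_add; rewrite memvZ ?memv_line.
Qed.

Let Y1 : ext C (4 + 4) := Psi (@y1_coef C).
Let Y2 : ext C (4 + 4) := Psi (@y2_coef C).

Let cY1 : complexify R (Psi (@y1_coef rat)) = Y1.
Proof.
rewrite complexify_Psi; apply: eq_Psi; rewrite /y1_coef; case.
do 6 (case; first by move=> ? /=;
  rewrite ?(rmorphXn, rmorphN, rmorphM, rmorph0, rmorph1) /= ?ratr_nat).
by [].
Qed.

Let cY2 : complexify R (Psi (@y2_coef rat)) = Y2.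
Proof.
rewrite complexify_Psi; apply: eq_Psi; rewrite /y2_coef; case.
do 6 (case; first by move=> ? /=;
  rewrite ?(rmorphN, rmorph0, rmorph1) /= ?ratr_nat).
by [].
Qed.

(* For v, w = (+- sqrt(-d), 1). *)
Let pencil_coefE (al be q : C) : pencil_coef a 1 (- a) 1 al be q =1 (fun j =>
  (al + be) * y1_coef C j + 2 * (al - be) * a * y2_coef C j +
  q * [:: 4 * d%:R ^+ 2; 8 * d%:R; 4; 0; 0; 0]`_j).
Proof.
have na2 : (- a) ^+ 2 = - d%:R by rewrite sqrrN.
rewrite /pencil_coef /sq_coef a2 na2 !mulr1 !expr1n.
have pa : 2 * a * (- a) = 2 * d%:R by rewrite -mulrA mulrN -expr2 a2 opprK.
rewrite pa subrr /y1_coef /y2_coef; case; do 6 (case; first by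
  move=> ? /=; rewrite ?a2 ?na2; ring).
by [].
Qed.

Let special_point : complexify R special_class =
  Psi (pencil_coef a 1 (- a) 1 (- (2 * d%:R)^-1) (- (2 * d%:R)^-1) (4 * d%:R)^-1).
Proof.
rewrite complexify_Psi; apply: eq_Psi => j; rewrite pencil_coefE; move: j.
rewrite /special_coef /y1_coef /y2_coef; case; do 6 (case; first by move=> ? /=;
  rewrite ?rmorph0 ?rmorph1 ?ratr_nat; field; rewrite ?dC ?pnatr_eq0).
by [].
Qed.

Let comb (al be : C) :
  al *: sq (omega_vec (vec1 a)) + be *: sq (omega_vec (vec1 (- a)))
  = (al + be) *: Y1 + (2 * (al - be) * a) *: Y2.
Proof.
have := pencil_coef_Psi (vec1 a) (vec1 (- a)) al be 0; rewrite scale0r addr0 => ->.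
rewrite !vec1E /Y1 /Y2 !PsiZ PsiD; apply: eq_Psi => j.
by rewrite pencil_coefE mul0r addr0.
Qed.

Let in_field_int_inv (k : nat) : in_field (k%:R^-1).
Proof. by have := in_field_rat k%:R^-1; rewrite fmorphV /= ratr_nat. Qed.

Let in_field_ainv : in_field a^-1.
Proof.
have -> : a^-1 = - 1 * (d%:R^-1 * a).
  apply: (mulfI a0); rewrite mulfV // mulN1r mulrN mulrCA -expr2 a2.
  by rewrite mulrN mulVf ?opprK.
apply: in_fieldM; first by have := in_field_rat (- 1); rewrite rmorphN1.
by apply: in_fieldM; [apply: in_field_int_inv|apply: in_field_root].
Qed.

(* Both sides are the span of Y1 and Y2 over Q(sqrt(-d)): one has omega_v^2 =
   Y1 + 2 sqrt(-d) Y2 and omega_w^2 = Y1 - 2 sqrt(-d) Y2. *)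
Let is_WK_quad : is_WK J K (vec1 a) (vec1 (- a)) WK.
Proof.
split=> [c /mem_WK [x [y ->]]|z].
  by rewrite !PsiZ PsiD; apply: hodge_class_Psi.
split=> [[l lK ->]|[al [be [/K_in_C_quad hal /K_in_C_quad hbe ->]]]].
  have ex (i : 'I_(\dim WK)) : exists xy : rat * rat, (vbasis WK)`_i =
      xy.1 *: Psi (@y1_coef rat) + xy.2 *: Psi (@y2_coef rat).
    have : (vbasis WK)`_i \in WK by apply/vbasis_mem/mem_nth; rewrite size_tuple.
    by move/mem_WK => [x [y ->]]; exists (x, y).
  have [xy hxy] := choice ex.
  pose s := \sum_i l i * ratr (xy i).1; pose t := \sum_i l i * ratr (xy i).2.
  have hs : in_field s.
    by apply: in_field_sum => i; apply: in_fieldM (in_field_rat _); apply/K_in_C_quad/lK.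
  have ht : in_field t.
    by apply: in_field_sum => i; apply: in_fieldM (in_field_rat _); apply/K_in_C_quad/lK.
  have h2 := in_field_int_inv 2; have h4 := in_field_int_inv 4.
  have hta : in_field (t * (4^-1 * a^-1)).
    exact: in_fieldM ht (in_fieldM h4 in_field_ainv).
  exists (s * 2^-1 + t * (4^-1 * a^-1)), (s * 2^-1 + (- 1) * (t * (4^-1 * a^-1))).
  split.
  - by apply/K_in_C_quad/in_fieldD => //; apply: in_fieldM.
  - apply/K_in_C_quad/in_fieldD; first by apply: in_fieldM.
    apply: in_fieldM => //; have := in_field_rat (- 1); by rewrite rmorphN1.
  - rewrite comb.
    rewrite (_ : s * 2^-1 + _ + _ = s); last by field.
    rewrite (_ : 2 * _ * a = t); last by field.
    rewrite /s /t !scaler_suml -big_split; apply: eq_bigr => i _ /=.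
    rewrite hxy complexify_comb cY1 cY2 scalerDr.
    exact: congr2 (scalerA _ _ _) (scalerA _ _ _).
pose e1 i := coord (vbasis WK) i (Psi (@y1_coef rat)).
pose e2 i := coord (vbasis WK) i (Psi (@y2_coef rat)).
have h1 : Psi (@y1_coef rat) \in WK.
  by apply/mem_WK; exists 1, 0; rewrite scale1r scale0r addr0.
have h2 : Psi (@y2_coef rat) \in WK.
  by apply/mem_WK; exists 0, 1; rewrite scale1r scale0r add0r.
exists (fun i => (al + be) * ratr (e1 i) + (2 * (al - be) * a) * ratr (e2 i)).
  move=> i; apply/K_in_C_quad/in_fieldD; apply: in_fieldM;
    try exact: in_field_rat; first exact: in_fieldD.
  apply: in_fieldM in_field_root; apply: in_fieldM.
    by have := in_field_rat 2; rewrite ratr_nat.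
  apply: in_fieldD => //; rewrite -mulN1r; apply: in_fieldM => //.
  by have := in_field_rat (- 1); rewrite rmorphN1.
rewrite comb -cY1 -cY2 {1}(coord_vbasis h1) {1}(coord_vbasis h2) !complexify_sum.
rewrite !scaler_sumr -big_split; apply: eq_bigr => i _ /=.
by rewrite !complexifyZ !scalerA -scalerDl.
Qed.

Let eigenbasis_quad : common_eigenbasis (tensorC R K) (vec1 a) (vec1 (- a)).
Proof.
split.
  rewrite unit_row_mx2 !vec1E !mulr1 opprK -mulr2n mulrn_eq0 /= //.
have eig b : b ^+ 2 = - d%:R -> {in tensorC R K, forall m,
    exists x, m *m vec1 b = x *: vec1 b}.
  move=> b2; apply: tensorC_eigen => k /mem_quad_field [x [y ->]].
  by exists (ratr x + ratr y * b); apply: quad_elt_eigen.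
by move=> m mT; split; apply: eig mT; rewrite ?sqrrN.
Qed.

Let pair_comb (al be q : C) :
  al *: sq (omega_vec (vec1 a)) + be *: sq (omega_vec (vec1 (- a)))
  + q *: sq (omega_pair (vec1 a) (vec1 (- a))) = Psi (pencil_coef a 1 (- a) 1 al be q).
Proof. by rewrite pencil_coef_Psi !vec1E. Qed.

Lemma special_class_deforms : deforms J K special_class.
Proof.
exists a, WK, (4 * d%:R)^-1, (- d%:R^-1 *: Psi (@y1_coef rat)) => /=.
rewrite ca; split.
- exact/K_in_C_quad/in_field_root.
- exact: eigenbasis_quad.
- exact: is_WK_quad.
- by apply: memvZ; apply/mem_WK; exists 1, 0; rewrite scale1r scale0r addr0.
- apply: etrans special_point _; apply: etrans (esym (pair_comb _ _ _)) _.
  rewrite addrC; apply: congr2.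
    by rewrite fmorphV rmorphM /= !ratr_nat.
  apply: etrans (comb _ _) _; apply: esym; apply: etrans (complexifyZ _ _ _) _.
  rewrite cY1 subrr mulr0 mul0r scale0r addr0; congr (_ *: _).
  by rewrite rmorphN fmorphV /= ratr_nat; field.
Qed.

Lemma special_class_singular L : \val L = <[complexify R special_class]>%VS ->
  Sing (Z J) L.
Proof.
move=> Lc; have [vw _] := eigenbasis_quad.
have Lp : \val L = <[Psi (pencil_coef (vec1 a 0 0) (vec1 a 1 0) (vec1 (- a) 0 0)
    (vec1 (- a) 1 0) (- (2 * d%:R)^-1) (- (2 * d%:R)^-1) (4 * d%:R)^-1)%R]>%VS.
  by rewrite Lc special_point !vec1E.
apply: (singular_point _ vw _ _ Lp).
- move=> Y _; apply; have [K' [cK eK]] := cartan_of_basis vw.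
  exists K', (vec1 a), (vec1 (- a)); split=> //.
  by rewrite Lp -memvE; apply/mem_B2K; do 3 eexists.
- by rewrite invr_neq0 // mulf_neq0 // ?dC // pnatr_eq0.
- by field.
Qed.
End SpecialClass.

Lemma special_class_neq0 : special_class <> 0.
Proof. by move/Psi_eq0/(_ 5%:R)/eqP; rewrite /special_coef /= oner_eq0. Qed.

Lemma infinitely_many_families (R : realType) (J : abelian_surface R) :
  exists (c : ext rat (4 + 4)) (L : proj (B2 J)),
     [/\ hodge_class_JJ J 2 c, c <> 0,
         \val L = <[complexify R c]>%VS,
         Sing (Z J) L &
         exists K : nat -> {vspace 'M[rat]_2},
           (forall n, imaginary_quadratic (K n) /\ deforms J (K n) c) /\
           (forall m n, m <> n -> ~ field_isomorphic (K m) (K n))].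
Proof.
pose c := special_class.
have c0 : complexify R c != 0.
  apply/eqP => h; apply: special_class_neq0; apply: (@complexify_inj R).
  by rewrite complexify0.
have cL : (<[complexify R c]> <= B2 J)%VS && (\dim <[complexify R c]>%VS == 1%N).
  rewrite dim_vline c0 andbT -memvE.
  by apply/hodge_space_mem/hodge_class_Psi.
exists c, (exist _ <[complexify R c]>%VS cL); split=> //.
- exact: hodge_class_Psi.
- exact: special_class_neq0.
- exact: (special_class_singular (isT : 0 < 1)%N).
exists (fun n => quad_field (prime_seq n)); split=> [n|m n mn].
  have n0 := prime_gt0 (prime_seq_prime n).
  by split; [apply: quad_field_imaginary|apply: special_class_deforms].
apply: quad_field_not_iso; try exact: prime_seq_prime.
by apply: contra_not_neq mn => /prime_seq_inj.
Qed.

Theorem theorem4p6 (R : realType) (J : abelian_surface R) (hJ : general J) :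
  (forall (c : ext rat (4 + 4)) (L : proj (B2 J)),
     hodge_class_JJ J 2 c -> c <> 0 ->
     \val L = <[complexify R c]>%VS ->
     Z J L -> ~ Sing (Z J) L ->
     forall K K' : {vspace 'M[rat]_2},
       imaginary_quadratic K -> imaginary_quadratic K' ->
       deforms J K c -> deforms J K' c -> K = K')
  /\
  (exists (c : ext rat (4 + 4)) (L : proj (B2 J)),
     [/\ hodge_class_JJ J 2 c, c <> 0,
         \val L = <[complexify R c]>%VS,
         Sing (Z J) L &
         exists K : nat -> {vspace 'M[rat]_2},
           (forall n, imaginary_quadratic (K n) /\ deforms J (K n) c) /\
           (forall m n, m <> n -> ~ field_isomorphic (K m) (K n))]).
Proof.
split=> [c L _ c0 Lc ZL nS|]; last exact: infinitely_many_families.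
exact: deforms_unique c0 Lc ZL nS.
Qed.
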